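(* Let $1<p<2<q<\infty$ satisfy $$\frac1p\ \ge\ \frac1q\log_2\binom{q}{q/2}.$$ Fix an integer $d\ge 1$, and for each $\omega\in\{0,1\}^d$ let $$G_\omega=\begin{pmatrix}A_\omega&B_\omega\\ \overline{B_\omega}&\overline{A_\omega}\end{pmatrix}\in\mathrm{SU}(1,1).$$ Set $P_\omega^{(0)}:=G_\omega$ for $\omega\in\{0,1\}^d$, and for $1\le n\le d$ and $\sigma\in\{0,1\}^{d-n}$ define recursively $$P_\sigma^{(n)}(t_1,\dots,t_n):=P_{\sigma0}^{(n-1)}(t_1,\dots,t_{n-1})\,D(t_n)\,P_{\sigma1}^{(n-1)}(t_1,\dots,t_{n-1})\,D(t_n)^{-1}.$$ For $t=(t_1,\dots,t_n)\in\mathbb{T}^n$ each $P_\sigma^{(n)}(t)$ belongs to $\mathrm{SU}(1,1)$; write $$P_\sigma^{(n)}(t)=\begin{pmatrix}a_\sigma^{(n)}(t)&b_\sigma^{(n)}(t)\\ \overline{b_\sigma^{(n)}(t)}&\overline{a_\sigma^{(n)}(t)}\end{pmatrix}.$$ Then $$\left\|\bigl(\log|a_\emptyset^{(d)}|^2\bigr)^{1/2}\right\|_{L^q(\mathbb{T}^d)}\le\left(\sum_{\omega\in\{0,1\}^d}\bigl(\log|A_\omega|^2\bigr)^{p/2}\right)^{1/p}.$$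
   Context: $\mathbb{T}=\mathbb{R}/\mathbb{Z}$ with normalized Haar measure, $\mathbb{T}^d$ with the product measure; $\log$ is the natural logarithm. For real $q>2$, $\binom{q}{q/2}:=\Gamma(q+1)/\Gamma(q/2+1)^2$. $\mathrm{SU}(1,1)$ is the group of complex matrices $\begin{pmatrix}A&B\\ \overline{B}&\overline{A}\end{pmatrix}$ with $|A|^2-|B|^2=1$. For $s\in\mathbb{R}$, $D(s):=\begin{pmatrix}e^{\pi i s}&0\\0&e^{-\pi i s}\end{pmatrix}$; conjugation $D(s)GD(s)^{-1}$ depends only on $s$ modulo $1$. For words $\sigma,\tau$ over $\{0,1\}$, $\sigma\tau$ is their concatenation, and $\{0,1\}^0=\{\emptyset\}$ with $\emptyset$ the empty word. *)

(* Defs.v *)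
From HB Require Import structures.
From mathcomp Require Import all_boot all_order all_algebra.
From mathcomp Require Import all_classical all_reals all_analysis.
From mathcomp Require Import complex.

Set Implicit Arguments.
Unset Strict Implicit.
Unset Printing Implicit Defensive.
Import Order.TTheory GRing.Theory Num.Theory.
Import numFieldNormedType.Exports.
Import ComplexField.

Local Open Scope classical_set_scope.
Local Open Scope ring_scope.
Local Open Scope complex_scope.
Local Open Scope quotient_scope.

(* Meaningful for [0 < x], where Euler's integral converges. *)
Definition Gamma (R : realType) (x : R) : R :=
  Rintegral (@lebesgue_measure R) `]0, +oo[
    (fun t => t `^ (x - 1) * expR (- t)).

Definition central_binomial (R : realType) (q : R) : R :=
  Gamma (q + 1) / Gamma (q / 2 + 1) ^+ 2.

Definition log2 (R : realType) (x : R) : R := ln x / ln 2.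

Definition integers (R : realType) : R -> bool := fun x => x \is a Num.int.

Lemma integers_zmod_closed (R : realType) : zmod_closed (@integers R).
Proof. by split=> [|x y]; rewrite !unfold_in; [exact: rpred0|exact: rpredB]. Qed.

HB.instance Definition _ (R : realType) :=
  GRing.isZmodClosed.Build R (@integers R) (@integers_zmod_closed R).

(* The additive group R/Z. *)
Definition circle (R : realType) : Type :=
  Quotient.quot (GRing.ZmodClosed.clone R (@integers R) _).

Section circle_measurable.
Variable R : realType.

HB.instance Definition _ := Choice.on (circle R).
HB.instance Definition _ := GRing.Zmodule.on (circle R).
HB.instance Definition _ := Quotient.on (circle R).
HB.instance Definition _ := isPointed.Build (circle R) 0.

(* The quotient sigma-algebra; it is the Borel sigma-algebra of R/Z. *)
Definition circle_measurable : set (set (circle R)) :=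
  [set A | measurable (\pi_(circle R) @^-1` A : set (measurableTypeR R))].

Let circle_measurable0 : circle_measurable set0.
Proof. by rewrite /circle_measurable /= preimage_set0. Qed.

Let circle_measurableC A :
  circle_measurable A -> circle_measurable (~` A).
Proof. by rewrite /circle_measurable /= preimage_setC => /measurableC. Qed.

Let circle_measurable_bigcup (F : (set (circle R))^nat) :
  (forall i, circle_measurable (F i)) -> circle_measurable (\bigcup_i F i).
Proof.
rewrite /circle_measurable /= preimage_bigcup => mF.
exact: bigcupT_measurable.
Qed.

Definition circle_display : measure_display. Proof. exact. Qed.

HB.instance Definition _ := @isMeasurable.Build circle_display (circle R)
  circle_measurable circle_measurable0 circle_measurableC
  circle_measurable_bigcup.
End circle_measurable.

Section circle_haar.
Variable R : realType.

Definition to_circle (s : measurableTypeR R) : circle R := \pi_(circle R) s.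

Lemma measurable_to_circle : measurable_fun setT to_circle.
Proof. by move=> _ A mA; rewrite setTI. Qed.

HB.instance Definition _ :=
  isMeasurableFun.Build _ _ _ _ to_circle measurable_to_circle.

(* Normalized Haar measure, as the image of Lebesgue measure on [0, 1]. *)
Definition circle_haar : probability (circle R) R :=
  distribution (uniform_prob (@ltr01 R)) to_circle.
End circle_haar.

Section product_probability.
Context d (T : measurableType d) (R : realType).

Definition tuple_rcons n (x : n.-tuple T * T) : n.+1.-tuple T :=
  [tuple of rcons x.1 x.2].

Lemma measurable_tuple_rcons n : measurable_fun setT (@tuple_rcons n).
Proof.
apply/measurable_fun_tnthP => i.
have [ilt|ige] := ltnP i n.
- rewrite (_ : _ \o _ = (fun x => tnth x.1 (Ordinal ilt))).
    by apply: (@measurableT_comp _ _ _ _ _ _ (fun x => tnth x (Ordinal ilt)));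
      [exact: measurable_tnth|exact: measurable_fst].
  apply/funext => -[x y] /=; rewrite !(tnth_nth y) /= nth_rcons size_tuple ilt.
  by [].
- rewrite (_ : _ \o _ = snd); first exact: measurable_snd.
  apply/funext => -[x y] /=; rewrite (tnth_nth y) /= nth_rcons size_tuple.
  have /eqP -> : i == n :> nat by rewrite eqn_leq ige andbT -ltnS.
  by rewrite ltnn eqxx.
Qed.

HB.instance Definition _ n :=
  isMeasurableFun.Build _ _ _ _ (@tuple_rcons n) (@measurable_tuple_rcons n).

Fixpoint tuple_prob (P : probability T R) (n : nat) :
    probability (n.-tuple T) R :=
  match n with
  | 0 => \d_ [tuple]
  | n.+1 => distribution (tuple_prob P n \x P)%E (@tuple_rcons n)
  end.

Lemma tuple_prob_box (P : probability T R) n (A : 'I_n -> set T) :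
  (forall i, measurable (A i)) ->
  tuple_prob P n [set t | forall i, A i (tnth t i)] = (\prod_(i < n) P (A i))%E.
Proof.
elim: n A => [|n IH] A mA.
  rewrite big_ord0 /= diracE (_ : _ \in _ = true) ?inE//=.
  by apply/mem_set => -[].
rewrite big_ord_recr /= -IH //.
rewrite /distribution /pushforward.
rewrite (_ : _ @^-1` _ =
    [set t | forall i, A (widen_ord (leqnSn n) i) (tnth t i)] `*` A ord_max).
  rewrite product_measure1E//.
  rewrite (_ : mkset _ = \bigcap_(i in [set: 'I_n])
      ((fun t : n.-tuple T => tnth t i) @^-1` A (widen_ord (leqnSn n) i))).
    apply: fin_bigcap_measurable => // i _.
    by rewrite -[X in measurable X]setTI; exact: measurable_tnth.
  by apply/seteqP; split => t /= h i; [move=> _; exact: h|exact: (h i I)].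
have nthl (t : n.-tuple T) y (i : 'I_n) :
    tnth (tuple_rcons (t, y)) (widen_ord (leqnSn n) i) = tnth t i.
  by rewrite !(tnth_nth y) /= nth_rcons size_tuple ltn_ord.
have nthr (t : n.-tuple T) y : tnth (tuple_rcons (t, y)) ord_max = y.
  by rewrite (tnth_nth y) /= nth_rcons size_tuple ltnn eqxx.
apply/seteqP; split => -[t y] /= => [h|[h hy] i].
  split=> [i|]; first by have := h (widen_ord (leqnSn n) i); rewrite nthl.
  by have := h ord_max; rewrite nthr.
have [ilt|ige] := ltnP i n.
  rewrite (_ : i = widen_ord (leqnSn n) (Ordinal ilt)); first by rewrite nthl.
  exact/val_inj.
rewrite (_ : i = ord_max) ?nthr//; apply/val_inj/eqP => /=.
by rewrite eqn_leq ige andbT -ltnS.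
Qed.
End product_probability.

Definition torus_haar (R : realType) (d : nat) :
    probability (d.-tuple (circle R)) R :=
  tuple_prob (circle_haar R) d.

Section su11.
Variable R : realType.
Implicit Types (s : R) (G : 'M[R[i]]_2).

Definition mx2 (a b c d : R[i]) : 'M[R[i]]_2 :=
  \matrix_(i, j) if i == 0 then (if j == 0 then a else b)
                 else (if j == 0 then c else d).

Definition su11_mx (A B : R[i]) : 'M[R[i]]_2 := mx2 A B B^* A^*.

Definition SU11 G : Prop := exists A B : R[i],
  Normc.normc A ^+ 2 - Normc.normc B ^+ 2 = 1 /\ G = su11_mx A B.

Definition expi s : R[i] := cos s +i* sin s.

Definition D s : 'M[R[i]]_2 := mx2 (expi (pi * s)) 0 0 (expi (- (pi * s))).

Definition conjD s G : 'M[R[i]]_2 := D s *m G *m invmx (D s).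

Lemma D1 s : D (s + 1) = - D s.
Proof.
have e x : expi (x + pi) = - expi x.
  by rewrite /expi cosDpi sinDpi; apply/eqP; rewrite eq_complex /= !eqxx.
have e' x : expi (x - pi) = - expi x by rewrite -[x in RHS](subrK pi) e opprK.
apply/matrixP => i j; rewrite !mxE mulrDr mulr1 opprD e e'.
by do 2 case: ifP => _; rewrite ?oppr0.
Qed.

Lemma D_unitmx s : D s \in unitmx.
Proof.
suff /mulmx1_unit[] : D s *m D (- s) = 1%:M by [].
have e x : expi x * expi (- x) = 1.
  apply/eqP; rewrite eq_complex /expi cosN sinN /= mulrN opprK -!expr2.
  by rewrite cos2Dsin2 eqxx mulrN mulrC addNr eqxx.
apply/matrixP => i j; rewrite !mxE big_ord_recr big_ord1 /= !mxE /=.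
case: i => -[|[|//]] /= ?; case: j => -[|[|//]] /= ?;
  by rewrite /= ?mulr0 ?mul0r ?addr0 ?add0r // mulrN ?e // mulrC e.
Qed.

Lemma conjD1 s G : conjD (s + 1) G = conjD s G.
Proof.
rewrite /conjD D1 -scaleN1r invmxZ; last first.
  rewrite unitmxE detZ unitrMl ?unitrX ?unitrN1 //.
  by rewrite -unitmxE D_unitmx.
by rewrite invrN1 !scaleN1r !mulNmx mulmxN opprK.
Qed.

Lemma conjDz s (m : int) G : conjD (s + m%:~R) G = conjD s G.
Proof.
elim: m => [|n IH|n IH]; first by rewrite addr0.
  by rewrite intS rmorphD /= addrCA addrA -addrA addrC conjD1 IH.
rewrite -[LHS]conjD1 -IH -addrA; congr (conjD (_ + _) _).
by rewrite -(intrD _ _ 1) -addn1 PoszD opprD addrNK.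
Qed.

(* [repr t] is an arbitrary representative; by [circle_conj_to_circle] below,
   the choice is irrelevant. *)
Definition circle_conj (t : circle R) G : 'M[R[i]]_2 := conjD (repr t) G.

Lemma circle_conj_to_circle s G : circle_conj (to_circle s) G = conjD s G.
Proof.
rewrite /circle_conj /to_circle.
have /intrP[m ms] : repr (\pi_(circle R) s) - s \is a Num.int.
  have := Quotient.idealrBE (GRing.ZmodClosed.clone R (@integers R) _)
    (repr (\pi_(circle R) s)) s.
  by rewrite reprK eqxx.
by rewrite -[repr _](subrK s) ms addrC conjDz.
Qed.

(* [twisted_product G e w t] is the product P_w^(n)(t_1, ..., t_n) attached to
   the word [w] of length [k = d - n]; the equation [e : k + n = d] ensures
   that [G] is only evaluated at words of length [d]. *)
Fixpoint twisted_product d (G : d.-tuple bool -> 'M[R[i]]_2) (n k : nat) :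
    (k + n = d)%N -> k.-tuple bool -> n.-tuple (circle R) -> 'M[R[i]]_2 :=
  match n with
  | 0 => fun e w _ => G (tcast (etrans (esym (addn0 k)) e) w)
  | n.+1 => fun e w t =>
      let e' := etrans (addSnnS k n) e in
      let t' := [tuple tnth t (widen_ord (leqnSn n) i) | i < n] in
      twisted_product G e' [tuple of rcons w false] t' *m
      circle_conj (tnth t ord_max) (twisted_product G e' [tuple of rcons w true] t')
  end.

End su11.

(* Main.v *)
Require Import Defs.
From mathcomp Require Import all_boot all_order all_algebra.
From mathcomp Require Import all_classical all_reals all_analysis.
From mathcomp Require Import measurable_realfun complex.
From mathcomp Require Import ring lra.
Import Order.TTheory GRing.Theory Num.Theory.
Import numFieldNormedType.Exports ComplexField.

(** Write [u = log |a|^2].  Integrating over the last coordinate and using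
    Minkowski's inequality in [L^(q/p)] reduces the theorem, by induction on [d],
    to a two-point inequality for the product of two matrices.  There
    [log |a|^2 = u0 + u1 + log |1 + r e^(2 pi i t)|^2] with
    [r^2 = (1 - e^-u0) (1 - e^-u1)], up to a rotation of [t].  This function is
    dominated in the convex order by
    [|u0^(1/2) + u1^(1/2) e^(2 pi i t)|^2 = u0 + u1 + 2 (u0 u1)^(1/2) cos (2 pi t)]:
    the two have the same mean (Jensen's formula) and cross only once as functions
    of [cos (2 pi t)].  So everything reduces to the linear inequality
    [||x + y e^(2 pi i t)||_q <= (x^p + y^p)^(1/p)].  With [y = 1], the [q]-th power
    of the left-hand side solves a hypergeometric equation in [x]; a Sturm
    comparison with the right-hand side shows that their quotient on [0, 1] first
    decreases and then increases, so it is maximal at [x = 0] or [x = 1].  At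
    [x = 1] the inequality is the hypothesis on the central binomial coefficient,
    because [||1 + e^(2 pi i t)||_q^q] and [Gamma (q+1) / Gamma (q/2+1)^2] satisfy
    the same recursion in [q] and agree asymptotically. *)

Set Implicit Arguments.
Unset Strict Implicit.
Unset Printing Implicit Defensive.

Local Open Scope ring_scope.
Local Open Scope classical_set_scope.

(** * Derivatives and continuity of real functions *)

Section derivatives.
Context {R : realType}.
Implicit Types f g : R -> R.

(** The two factors of a product are functions of the same coordinates t_1, ..., t_(n-1), so they
    are not independent: the only averaging available at each level is the one over t_n, with the
    values u0 and u1 frozen. The two-point inequality must therefore hold with constant 1, since a
    loss would be repeated at each of the d levels. The function |u0^(1/2) + u1^(1/2) e^(2 pi i
    t)|^2 is the leading part of u for small u0, u1, where r is close to c = (u0 u1)^(1/2); the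
    linear problem is thus the worst case. The single crossing comes from the concavity of 1 + r^2 +
    2 r z - e^(2 c z) in z = cos (2 pi t), together with its sign at z = -1, which amounts to r <= 1
    - e^-c. In the Sturm comparison the turning point of the quotient is never located: one explicit
    function, [sign_fun], changes sign at most once on ]0, 1[, and the bound 1 < p serves to make it
    convex in x^2. *)

Lemma is_deriveD_fun f g (x a b : R) : is_derive x 1 f a -> is_derive x 1 g b ->
  is_derive x 1 (fun y => f y + g y) (a + b).
Proof. exact: is_deriveD. Qed.

Lemma is_deriveN_fun f (x a : R) : is_derive x 1 f a ->
  is_derive x 1 (fun y => - f y) (- a).
Proof. exact: is_deriveN. Qed.

Lemma is_deriveB_fun f g (x a b : R) : is_derive x 1 f a -> is_derive x 1 g b ->
  is_derive x 1 (fun y => f y - g y) (a - b).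
Proof. exact: is_deriveB. Qed.

Lemma is_deriveM_fun f g (x a b : R) : is_derive x 1 f a -> is_derive x 1 g b ->
  is_derive x 1 (fun y => f y * g y) (a * g x + f x * b).
Proof.
move=> fa gb; apply: (is_derive_eq (is_deriveM fa gb)).
by rewrite /GRing.scale/= addrC (mulrC (g x)).
Qed.

Lemma is_deriveZ_fun (c : R) f (x a : R) : is_derive x 1 f a ->
  is_derive x 1 (fun y => c * f y) (c * a).
Proof. by move=> fa; exact: (@is_deriveZ _ _ _ f c). Qed.

Lemma is_derive_powR_fun f (x a r : R) : is_derive x 1 f a -> 0 < f x ->
  is_derive x 1 (fun y => f y `^ r) (r * f x `^ (r - 1) * a).
Proof.
by move=> fa f0; exact: (is_derive1_comp (is_derive1_powR r f0) fa).
Qed.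

Lemma is_derive_idr (x : R) : is_derive x 1 (fun y => y) 1.
Proof. exact: is_derive_id. Qed.

Lemma is_derive_cstr (c x : R) : is_derive x 1 (fun=> c) 0.
Proof. exact: is_derive_cst. Qed.

Lemma is_derive_sqr (x : R) : is_derive x 1 (fun y => y ^+ 2) (2 * x).
Proof.
have -> : (fun y : R => y ^+ 2) = (fun y => y * y) by apply/funext => y; rewrite expr2.
have dx := is_derive_idr x.
apply: (is_derive_eq (is_deriveM_fun dx dx)).
by rewrite mul1r mulr1 mulr_natl.
Qed.

Lemma is_derive_continuous f (x a : R) : is_derive x 1 f a -> {for x, continuous f}.
Proof.
by move=> fa; apply: differentiable_continuous; apply/derivable1_diffP; exact: ex_derive.
Qed.

Lemma is_derive1E f (x a : R) : is_derive x 1 f a -> f^`() x = a.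
Proof. by move=> fa; rewrite derive1E derive_val. Qed.

Lemma is_derive_ndecr f (f' : R -> R) (a b : R) : {within `[a, b], continuous f} ->
  (forall x, a < x < b -> is_derive x 1 f (f' x)) ->
  (forall x, a < x < b -> 0 <= f' x) ->
  forall x y, a <= x -> x <= y -> y <= b -> f x <= f y.
Proof.
move=> cf df f0 x y ax xy yb; apply: (@ger0_derive1_le_cc _ f a b) => //.
- by move=> z; rewrite in_itv => /df ?; exact: ex_derive.
- by move=> z; rewrite in_itv => zab; rewrite (is_derive1E (df _ zab)) f0.
- by rewrite in_itv/= ax (le_trans xy).
- by rewrite in_itv/= yb andbT (le_trans ax).
Qed.

Lemma is_derive_nincr f (f' : R -> R) (a b : R) : {within `[a, b], continuous f} ->
  (forall x, a < x < b -> is_derive x 1 f (f' x)) ->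
  (forall x, a < x < b -> f' x <= 0) ->
  forall x y, a <= x -> x <= y -> y <= b -> f y <= f x.
Proof.
move=> cf df f0 x y ax xy yb; apply: (@ler0_derive1_le_cc _ f a b) => //.
- by move=> z; rewrite in_itv => /df ?; exact: ex_derive.
- by move=> z; rewrite in_itv => zab; rewrite (is_derive1E (df _ zab)) f0.
- by rewrite in_itv/= yb andbT (le_trans ax).
- by rewrite in_itv/= ax (le_trans xy).
Qed.

Lemma is_derive0_cst f (a b : R) : (forall x, a < x < b -> is_derive x 1 f 0) ->
  forall x y, a < x < b -> a < y < b -> f x = f y.
Proof.
move=> df; suff H x y : a < x < b -> a < y < b -> x <= y -> f x = f y.
  by move=> x y hx hy; have [/H->//|/ltW/H<-//] := leP x y.
move=> /andP[ax xb] /andP[ay yb] xy.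
have cf : {within `[x, y], continuous f}.
  apply: continuous_in_subspaceT => z; rewrite inE/= in_itv/= => /andP[xz zy].
  by apply: (@is_derive_continuous _ _ 0); apply: df; rewrite (lt_le_trans ax) ?(le_lt_trans zy).
have df' z : x < z < y -> is_derive z 1 f 0.
  by move=> /andP[xz zy]; apply: df; rewrite (lt_trans ax) ?(lt_trans zy).
apply/le_anti/andP; split.
  by apply: (is_derive_ndecr cf df').
by apply: (is_derive_nincr cf df').
Qed.

Lemma continuous_within f (A : set R) : continuous f -> {within A, continuous f}.
Proof. exact: continuous_subspaceT. Qed.

Lemma cts_at_comp f g (x : R) : {for x, continuous f} -> {for f x, continuous g} ->
  {for x, continuous (fun y => g (f y))}.
Proof. exact: continuous_comp. Qed.

Lemma cts_comp f g : continuous f -> continuous g -> continuous (fun x => g (f x)).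
Proof. by move=> cf cg x; apply: continuous_comp; [exact: cf|exact: cg]. Qed.

Lemma ctsD f g : continuous f -> continuous g -> continuous (fun x => f x + g x).
Proof. by move=> cf cg x; apply: cvgD; [exact: cf|exact: cg]. Qed.

Lemma ctsB f g : continuous f -> continuous g -> continuous (fun x => f x - g x).
Proof. by move=> cf cg x; apply: cvgB; [exact: cf|exact: cg]. Qed.

Lemma ctsM f g : continuous f -> continuous g -> continuous (fun x => f x * g x).
Proof. by move=> cf cg x; apply: cvgM; [exact: cf|exact: cg]. Qed.

Lemma cts_id : continuous (fun x : R => x).
Proof. by move=> x; exact: cvg_id. Qed.

Lemma cts_cst (c : R) : continuous (fun _ : R => c).
Proof. by move=> x; exact: cvg_cst. Qed.

(** With the absolute value the power is continuous on the whole line, whereas a power of a negative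
    number is only a default value. The functions [w] and [Y] below are written with an absolute
    value for this reason. *)
Lemma continuous_norm_powR (a : R) : 0 < a -> continuous (fun x : R => `|x| `^ a).
Proof.
move=> a0 x; have [->|x0] := eqVneq x 0; last first.
  have h1 : {for x, continuous (fun y : R => `|y| : R)} by exact: norm_continuous.
  have h2 : {for `|x|, continuous (fun y : R => y `^ a)}.
    by apply: is_derive_continuous; apply: is_derive1_powR; rewrite normr_gt0.
  exact: (cts_at_comp h1 h2).
apply/cvgrPdist_le => /= e e0; near=> y.
rewrite normr0 powR0 ?gt_eqF// sub0r normrN ger0_norm ?powR_ge0//.
have -> : e = (e `^ a^-1) `^ a by rewrite -powRrM mulVf ?gt_eqF// powRr1 ?ltW.
have yb : `|y| < e `^ a^-1.
  near: y; apply/nbhs_ballP; exists (e `^ a^-1); first exact: powR_gt0.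
  by move=> z; rewrite /ball/= sub0r normrN.
by rewrite ge0_ler_powR ?nnegrE ?powR_ge0 ?(ltW yb) ?(ltW a0).
Unshelve. all: end_near. Qed.

Lemma cts_powR f (a : R) : 0 <= a -> continuous f -> (forall x, 0 <= f x) ->
  continuous (fun x => f x `^ a).
Proof.
rewrite le_eqVlt => /predU1P[<- _ _|a0 cf f0].
  rewrite (_ : (fun _ => _) = cst 1); first exact: cts_cst.
  by apply/funext => x; rewrite powRr0.
rewrite (_ : (fun _ => _) = (fun x => `|f x| `^ a)).
  exact: (cts_comp cf (continuous_norm_powR a0)).
by apply/funext => x; rewrite ger0_norm.
Qed.

Lemma cts_powR_gt0 f (a : R) : continuous f -> (forall x, 0 < f x) ->
  continuous (fun x => f x `^ a).
Proof.
move=> cf f0 x; apply: (@cts_at_comp f (fun y : R => y `^ a)); first exact: cf.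
by apply: is_derive_continuous; exact: is_derive1_powR.
Qed.

Lemma cts_ln f : continuous f -> (forall x, 0 < f x) -> continuous (fun x => ln (f x)).
Proof.
move=> cf f0 x; apply: (@cts_at_comp f (@ln R)); first exact: cf.
exact: continuous_ln.
Qed.

Lemma continuous_limit_le f (a b c : R) : a < b -> {for b, continuous f} ->
  (forall x, a < x < b -> c <= f x) -> c <= f b.
Proof.
move=> ab cf H; have fb : f x @[x --> b^'-] --> f b by exact: cvg_at_left_filter.
rewrite -(cvg_lim (@Rhausdorff R) fb); apply: limr_ge; first by apply/cvg_ex; exists (f b).
by near=> x; apply: H; apply/andP; split.
Unshelve. all: end_near. Qed.

End derivatives.

(** * Means over the circle *)

Definition mean (R : realType) (f : R -> R) : R :=
  \int[@lebesgue_measure R]_(t in `[0, 1]) f t.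

Section mean.
Context {R : realType}.
Implicit Types f g F H : R -> R.
Local Notation mu := (@lebesgue_measure R).

Lemma continuous_integrable01 f : continuous f -> mu.-integrable `[0, 1] (EFin \o f).
Proof.
move=> cf; apply: continuous_compact_integrable; first exact: segment_compact.
exact: continuous_subspaceT.
Qed.

Lemma meanD f g : continuous f -> continuous g ->
  mean (fun t => f t + g t) = mean f + mean g.
Proof. by move=> cf cg; rewrite /mean RintegralD//; exact: continuous_integrable01. Qed.

Lemma meanB f g : continuous f -> continuous g ->
  mean (fun t => f t - g t) = mean f - mean g.
Proof. by move=> cf cg; rewrite /mean RintegralB//; exact: continuous_integrable01. Qed.

Lemma meanZ c f : continuous f -> mean (fun t => c * f t) = c * mean f.
Proof. by move=> cf; rewrite /mean RintegralZl//; exact: continuous_integrable01. Qed.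

Lemma mean_cst (c : R) : mean (fun=> c) = c.
Proof.
rewrite /mean Rintegral_cst//= lebesgue_measure_itv/= lte_fin ltr01 oppr0 addr0.
by rewrite mulr1.
Qed.

Lemma le_mean f g : continuous f -> continuous g -> (forall t, f t <= g t) ->
  mean f <= mean g.
Proof.
move=> cf cg fg; apply: le_Rintegral => //; exact: continuous_integrable01.
Qed.

Lemma mean_FTC F f : continuous f -> (forall t : R, is_derive t 1 F (f t)) ->
  mean f = F 1 - F 0.
Proof.
move=> cf dF; rewrite /mean /Rintegral (@continuous_FTC2 _ f F)//.
- exact: continuous_subspaceT.
- split.
  + by move=> x _; exact: ex_derive.
  + by apply: cvg_at_right_filter; apply: is_derive_continuous (dF 0).
  + by apply: cvg_at_left_filter; apply: is_derive_continuous (dF 1).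
- by move=> x _; exact: is_derive1E.
Qed.

Lemma mean_FTC_itv F f (a b : R) : a < 0 -> 1 < b -> continuous f ->
  (forall t, a < t < b -> is_derive t 1 F (f t)) -> mean f = F 1 - F 0.
Proof.
move=> a0 b1 cf dF; rewrite /mean /Rintegral (@continuous_FTC2 _ f F)//.
- exact: continuous_subspaceT.
- have H (t : R) : 0 <= t <= 1 -> is_derive t 1 F (f t).
    by move=> /andP[t0 t1]; apply: dF; rewrite (lt_le_trans a0)// (le_lt_trans t1).
  split.
  + by move=> x; rewrite in_itv/= => /andP[/ltW x0 /ltW x1]; apply: ex_derive; apply: H; rewrite x0.
  + by apply: cvg_at_right_filter; apply: is_derive_continuous (H 0 _); rewrite lexx ler01.
  + by apply: cvg_at_left_filter; apply: is_derive_continuous (H 1 _); rewrite lexx ler01.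
- move=> x; rewrite in_itv/= => /andP[x0 x1]; apply: is_derive1E; apply: dF.
  by rewrite (lt_trans a0)// (lt_trans x1).
Qed.

(** Integrating from the fixed point [- M] gives an antiderivative on a bounded interval; each use
    picks [M] large enough to contain all arguments that occur. *)
Lemma antiderivative f (M : R) : continuous f ->
  exists H : R -> R, forall x : R, - M < x < M -> is_derive x 1 H (f x).
Proof.
move=> cf; exists (fun x => \int[mu]_(t in `[- M, x]) f t) => x /andP[Mx xM].
have int : mu.-integrable `[- M, M] (EFin \o f).
  apply: continuous_compact_integrable; first exact: segment_compact.
  exact: continuous_subspaceT.
have [d e] := continuous_FTC1_closed xM int Mx (cf x).
by apply: DeriveDef => //; rewrite -derive1E.
Qed.

Lemma is_derive_affine (k c x : R) : is_derive x 1 (fun y => k * y + c) k.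
Proof.
apply: (is_derive_eq (is_deriveD_fun (is_deriveZ_fun k (is_derive_idr x)) (is_derive_cstr c x))).
by rewrite mulr1 addr0.
Qed.

Lemma cts_affine (k c : R) : continuous (fun y : R => k * y + c).
Proof. by move=> x; exact: is_derive_continuous (is_derive_affine k c x). Qed.

Lemma mean_affine f (k c M : R) (H : R -> R) : continuous f -> 0 < k ->
  (forall x : R, - M < x < M -> is_derive x 1 H (f x)) ->
  `|c| + k < M -> k * mean (fun t => f (k * t + c)) = H (k + c) - H c.
Proof.
move=> cf k0 dH cM.
have cfa : continuous (fun t => f (k * t + c)) := cts_comp (@cts_affine k c) cf.
rewrite -meanZ//.
have := ler_norm c; have := ler_norm (- c); rewrite normrN => c1 c2.
pose e := (M - `|c| - k) / k.
have e0 : 0 < e by rewrite divr_gt0//; lra.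
have dHa (t : R) : - e < t < 1 + e ->
    is_derive t 1 (fun t => H (k * t + c)) (k * f (k * t + c)).
  move=> /andP[t0 t1]; rewrite mulrC.
  apply: (@is_derive1_comp _ H (fun t => k * t + c) t _ _ _ (is_derive_affine k c t)).
  apply: dH.
  have ke : k * e = M - `|c| - k by rewrite /e mulrC divfK// gt_eqF.
  have : k * - e < k * t by rewrite ltr_pM2l.
  have : k * t < k * (1 + e) by rewrite ltr_pM2l.
  by rewrite mulrDr mulrN ke mulr1; lra.
have cka : continuous (fun t => k * f (k * t + c)) by apply: ctsM; [exact: cts_cst|exact: cfa].
have e0N : - e < 0 by rewrite oppr_lt0.
have e1 : 1 < 1 + e by rewrite ltrDl.
by rewrite (mean_FTC_itv e0N e1 cka dHa) mulr1 mulr0 add0r.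
Qed.

Section periodic.
Context (f : R -> R).
Context (cf : continuous f).
Context (pf : forall t, f (t + 1) = f t).

(** With [H] an antiderivative of [f], the shifted mean is [H (1 + b) - H b], whose derivative in
    [b] is [f (b + 1) - f b = 0]. *)
Lemma mean_shift (c : R) : mean (fun t => f (t + c)) = mean f.
Proof.
pose M := `|c| + 3; have c0 := normr_ge0 c.
have [H dH] := antiderivative M cf.
have E b : - (`|c| + 1) < b < `|c| + 1 -> mean (fun t => f (t + b)) = H (1 + b) - H b.
  move=> hb; have := @mean_affine f 1 b M H cf ltr01 dH.
  rewrite mul1r => <-; first by congr mean; apply/funext => t; rewrite mul1r.
  have bc : `|b| < `|c| + 1 by rewrite ltr_norml.
  by rewrite /M; lra.
have dD (x : R) : - (`|c| + 1) < x < `|c| + 1 -> is_derive x 1 (fun b => H (1 + b) - H b) 0.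
  move=> xb; rewrite (_ : 0 = f (x + 1) * 1 - f x); last by rewrite pf mulr1 subrr.
  apply: is_deriveB_fun; last by apply: dH; rewrite /M; lra.
  have h : is_derive x 1 (fun y => 1 + y) 1.
    by apply: (is_derive_eq (is_deriveD_fun (is_derive_cstr 1 x) (is_derive_idr x))); rewrite add0r.
  apply: (@is_derive1_comp _ H (fun y => 1 + y) x _ _ _ h).
  by rewrite addrC; apply: dH; rewrite /M; lra.
have c1 := ler_norm c; have c2 := ler_norm (- c); rewrite normrN in c2.
rewrite E; last by lra.
rewrite -(@is_derive0_cst _ _ _ _ dD 0 c); [|by lra|by lra].
rewrite -E; last by lra.
by congr mean; apply/funext => t; rewrite addr0.
Qed.

(** Twice the left-hand side is the increment of [H] from [c] to [2 + c], that is, over two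
    periods. *)
Lemma mean_double (c : R) : mean (fun t => f (2 * t + c)) = mean f.
Proof.
pose M := `|c| + 5; have c0 := normr_ge0 c.
have [H dH] := antiderivative M cf.
have E1 := @mean_affine f 2 c M H cf (ltr0Sn R 1) dH.
have E2 := @mean_affine f 1 c M H cf ltr01 dH.
have E3 := @mean_affine f 1 (1 + c) M H cf ltr01 dH.
have n1 : `|1 + c| <= 1 + `|c| by rewrite (le_trans (ler_normD _ _))// normr1.
move: E1 E2 E3; rewrite !mul1r.
have -> : (fun t => f (1 * t + c)) = (fun t => f (t + c)) by apply/funext => t; rewrite mul1r.
have -> : (fun t => f (1 * t + (1 + c))) = (fun t => f (t + (1 + c))).
  by apply/funext => t; rewrite mul1r.
rewrite !mean_shift (_ : 1 + (1 + c) = 2 + c); last by lra.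
rewrite /M => E1 E2 E3.
have {}E1 := E1 ltac:(lra); have {}E2 := E2 ltac:(lra); have {}E3 := E3 ltac:(lra).
by lra.
Qed.

End periodic.

Lemma mean_continuous (f : R -> R -> R) (a b C x : R) : a < x < b ->
  (forall y, a < y < b -> continuous (f y)) ->
  (forall t, continuous (f ^~ t)) ->
  (forall y t, a < y < b -> `|f y t| <= C) ->
  {for x, continuous (fun y => mean (f y))}.
Proof.
move=> xab cf cf' fC.
apply: (@continuity_under_integral R _ _ mu f `[0, 1] _ a b _ _ (fun=> C)) => //.
- by move=> y; rewrite /= in_itv/= => yab; apply: continuous_integrable01; exact: cf.
- by apply: aeW => t _ y _; exact: cf'.
- by apply: continuous_integrable01; exact: cts_cst.
- by move=> y; rewrite /= in_itv/= => yab; apply: aeW => t _; exact: fC.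
- by rewrite inE/= in_itv.
Qed.

Lemma mean_derive (f f' : R -> R -> R) (a b C x : R) : a < x < b ->
  (forall y, a < y < b -> continuous (f y)) ->
  (forall y t, a < y < b -> is_derive y 1 (f ^~ t) (f' y t)) ->
  (forall y t, a < y < b -> `|f' y t| <= C) ->
  is_derive x 1 (fun y => mean (f y)) (mean (f' x)).
Proof.
move=> xab cf df fC.
have C0 : 0 <= C by rewrite (le_trans _ (fC x 0 xab)).
have E y t : a < y < b -> partial1of2 f y t = f' y t.
  by move=> yab; rewrite partial1of2E; have ? := df y t yab; exact: derive_val.
have h1 : forall y, `]a, b[ y -> mu.-integrable `[0, 1] (EFin \o f y).
  by move=> y; rewrite /= in_itv/= => yab; apply: continuous_integrable01; exact: cf.
have h2 : forall y t, `]a, b[ y -> `[0, 1] t -> derivable (f ^~ t) y 1.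
  by move=> y t; rewrite /= in_itv/= => yab _; have ? := df y t yab; exact: ex_derive.
have h3 : mu.-integrable `[0, 1] (EFin \o (fun=> C)).
  by apply: continuous_integrable01; exact: cts_cst.
have h4 : forall y t, `]a, b[ y -> `[0, 1] t -> `|partial1of2 f y t| <= C.
  by move=> y t; rewrite /= in_itv/= => yab _; rewrite E//; exact: fC.
have h0 : `]a, b[ x by rewrite /= in_itv.
have m01 : measurable (`[0%R, 1%R]%classic : set (measurableTypeR R)) by [].
apply: DeriveDef.
  exact: (derivable_under_integral m01 h0 h1 h2 (fun=> C0) h3 h4).
rewrite -derive1E (differentiation_under_integral m01 h0 h1 h2 (fun=> C0) h3 h4).
by apply: eq_Rintegral => t _; rewrite E.
Qed.

End mean.

(** * Means of the powers of |1 + x e^(2 pi i t)|^2 *)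

Section circle_powers.
Context {R : realType}.
Implicit Types a x t : R.

Definition ccos (t : R) : R := cos (2 * pi * t).
Definition csin (t : R) : R := sin (2 * pi * t).

Lemma is_derive_2pi t : is_derive t 1 (fun t : R => 2 * pi * t) (2 * pi).
Proof.
by apply: (is_derive_eq (is_deriveZ_fun (2 * pi) (is_derive_idr t))); rewrite mulr1.
Qed.

Lemma is_derive_ccos t : is_derive t 1 ccos (- csin t * (2 * pi)).
Proof. exact: (is_derive1_comp (is_derive_cos (2 * pi * t)) (is_derive_2pi t)). Qed.

Lemma is_derive_csin t : is_derive t 1 csin (ccos t * (2 * pi)).
Proof. exact: (is_derive1_comp (is_derive_sin (2 * pi * t)) (is_derive_2pi t)). Qed.

Lemma continuous_ccos : continuous ccos.
Proof. by move=> t; exact: is_derive_continuous (is_derive_ccos t). Qed.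

Lemma ccosD1 t : ccos (t + 1) = ccos t.
Proof. by rewrite /ccos mulrDr mulr1 mulr_natl cosD2pi. Qed.

Lemma ccosDhalf t : ccos (t + 2^-1) = - ccos t.
Proof.
rewrite /ccos (_ : 2 * pi * (t + 2^-1) = 2 * pi * t + pi); first exact: cosDpi.
by field.
Qed.

Lemma ccos_double t : ccos (2 * t) = 2 * ccos t ^+ 2 - 1.
Proof.
by rewrite /ccos mulrCA (mulr_natl (2 * pi * t) 2) cos_mulr2n (mulr_natl (cos _ ^+ 2) 2).
Qed.

Lemma ccos_le1 t : -1 <= ccos t <= 1.
Proof. by rewrite cos_geN1 cos_le1. Qed.

Lemma ccos_csin t : csin t ^+ 2 = 1 - ccos t ^+ 2.
Proof. by have := cos2Dsin2 (2 * pi * t); rewrite /csin /ccos; lra. Qed.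

Lemma mean_ccos : mean ccos = 0.
Proof.
have H t : is_derive t 1 (fun t => csin t * (2 * pi)^-1) (ccos t).
  have p0 : 2 * pi != 0 :> R by rewrite mulf_neq0 ?pnatr_eq0// gt_eqF// pi_gt0.
  apply: (is_derive_eq (is_deriveM_fun (is_derive_csin t) (is_derive_cstr (2 * pi)^-1 t))).
  by rewrite mulr0 addr0 mulfK.
rewrite (mean_FTC continuous_ccos H) /csin mulr1 mulr0 sin0 mulr_natl.
by rewrite sin2pi mul0r subr0.
Qed.

(* |1 + x e^{2 pi i t}|^2 *)
Definition sqr_dist (x t : R) : R := 1 + x ^+ 2 + 2 * x * ccos t.

Lemma is_derive_sqr_dist x t :
  is_derive t 1 (sqr_dist x) (- (4 * pi * x * csin t)).
Proof.
apply: (is_derive_eq (is_deriveD_fun (is_derive_cstr (1 + x ^+ 2) t)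
  (is_deriveZ_fun (2 * x) (is_derive_ccos t)))).
by ring.
Qed.

Lemma is_derive_sqr_distl x t :
  is_derive x 1 (sqr_dist ^~ t) (2 * x + 2 * ccos t).
Proof.
have h1 := is_deriveD_fun (is_derive_cstr 1 x) (is_derive_sqr x).
have h2 := is_deriveM_fun (is_deriveZ_fun 2 (is_derive_idr x)) (is_derive_cstr (ccos t) x).
by apply: (is_derive_eq (is_deriveD_fun h1 h2)); ring.
Qed.

Lemma continuous_sqr_dist x : continuous (sqr_dist x).
Proof. by move=> t; exact: is_derive_continuous (is_derive_sqr_dist x t). Qed.

Lemma continuous_sqr_distl t : continuous (sqr_dist ^~ t).
Proof. by move=> x; exact: is_derive_continuous (is_derive_sqr_distl x t). Qed.

Lemma sqr_dist_ge x t : 0 <= x -> (1 - x) ^+ 2 <= sqr_dist x t.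
Proof.
move=> x0; have /andP[c1 _] := ccos_le1 t; rewrite /sqr_dist -subr_ge0.
rewrite (_ : _ - _ = 2 * x * (ccos t + 1)); last by ring.
by rewrite !mulr_ge0//; lra.
Qed.

Lemma sqr_dist_ge0 x t : 0 <= sqr_dist x t.
Proof.
rewrite /sqr_dist (_ : _ + _ = (x + ccos t) ^+ 2 + (1 - ccos t ^+ 2)); last by ring.
by rewrite -ccos_csin addr_ge0// sqr_ge0.
Qed.

Lemma sqr_dist_gt0 x t : 0 <= x -> x < 1 -> 0 < sqr_dist x t.
Proof.
move=> x0 x1; apply: lt_le_trans (sqr_dist_ge t x0).
by rewrite exprn_gt0// subr_gt0.
Qed.

(** The range of [x] is an open neighbourhood of [0, 1], as passing to the limit under the integral
    at the end points requires. The constant is 3^2 for [(x + ccos t) ^+ 2] plus 1 for the squared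
    sine. *)
Lemma sqr_dist_le x t : -1 < x < 2 -> sqr_dist x t <= 10.
Proof.
move=> /andP[x0 x1]; have /andP[c1 c2] := ccos_le1 t; rewrite /sqr_dist.
have : (x + ccos t) ^+ 2 <= 9.
  rewrite (_ : 9 = 3 ^+ 2); last by ring.
  by rewrite -real_normK ?num_real// lerXn2r ?nnegrE ?normr_ge0// ler_norml; lra.
have : 0 <= ccos t ^+ 2 by rewrite sqr_ge0.
by lra.
Qed.

Lemma powR_pred (z a : R) : 0 < z -> z `^ a = z * z `^ (a - 1).
Proof.
move=> z0; rewrite -{2}(powRr1 (ltW z0)) -powRD ?(gt_eqF z0) ?implybT//.
by rewrite addrC subrK.
Qed.

(** For [0 <= x < 1] this is the hypergeometric function 2F1(-a, -a; 1; x^2); for [a = q / 2] it is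
    the q-th power of the L^q norm of 1 + x e^(2 pi i t). *)
Definition pow_mean (a x : R) : R := mean (fun t => sqr_dist x t `^ a).

Lemma continuous_sqr_dist_powR a x : 0 <= a -> continuous (fun t => sqr_dist x t `^ a).
Proof.
move=> a0; apply: cts_powR => //; first exact: continuous_sqr_dist.
by move=> t; exact: sqr_dist_ge0.
Qed.

Lemma continuous_sqr_dist_powR_lt1 a x : 0 <= x -> x < 1 ->
  continuous (fun t => sqr_dist x t `^ a).
Proof.
move=> x0 x1; apply: cts_powR_gt0; first exact: continuous_sqr_dist.
by move=> t; exact: sqr_dist_gt0.
Qed.

Lemma continuous_pow_mean a x : 0 <= a -> 0 <= x <= 1 ->
  {for x, continuous (pow_mean a)}.
Proof.
move=> a0 x01; apply: (@mean_continuous _ (fun x t => sqr_dist x t `^ a) (-1) 2 (10 `^ a)).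
- by lra.
- by move=> y _; exact: continuous_sqr_dist_powR.
- move=> t; apply: cts_powR => //; first exact: continuous_sqr_distl.
  by move=> y; exact: sqr_dist_ge0.
- move=> y t y01; rewrite ger0_norm ?powR_ge0// ge0_ler_powR// ?nnegrE ?sqr_dist_ge0//.
  exact: sqr_dist_le.
Qed.

Lemma pow_mean0 a : pow_mean a 0 = 1.
Proof.
rewrite /pow_mean -[RHS]mean_cst; congr mean; apply/funext => t.
by rewrite /sqr_dist expr0n/= mulr0 mul0r !addr0 powR1.
Qed.

Lemma pow_mean_ge0 a x : 0 <= pow_mean a x.
Proof. by apply: Rintegral_ge0 => t _; exact: powR_ge0. Qed.

Lemma powR_bound a (m M z : R) : 0 < m -> m <= z <= M -> z `^ a <= m `^ a + M `^ a.
Proof.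
move=> m0 /andP[mz zM]; have z0 := lt_le_trans m0 mz.
have [a0|a0] := leP 0 a.
  apply: (@le_trans _ _ (M `^ a)); last by rewrite lerDr powR_ge0.
  by rewrite ge0_ler_powR// nnegrE ltW// (lt_le_trans z0).
apply: (@le_trans _ _ (m `^ a)); last by rewrite lerDl powR_ge0.
rewrite -(opprK a) !(powRN _ (- a)) lef_pV2 ?posrE ?powR_gt0//.
by rewrite ge0_ler_powR// ?nnegrE ?oppr_ge0 ltW.
Qed.

(** The cosine produced by differentiation is itself affine in [sqr_dist x t], so only means of
    powers remain. *)
Lemma is_derive_pow_mean a x : 0 < x < 1 ->
  is_derive x 1 (pow_mean a)
    (a / x * (pow_mean a x - (1 - x ^+ 2) * pow_mean (a - 1) x)).
Proof.
(* Domination is sought on []0, v[], away from 1: the exponent [a - 1] may be negative, and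
   [sqr_dist 1] vanishes at t = 1/2. *)
move=> /andP[x0 x1]; pose v := (1 + x) / 2.
have v1 : v < 1 by rewrite /v; lra.
have xv : x < v by rewrite /v; lra.
pose f' (y t : R) := a * sqr_dist y t `^ (a - 1) * (2 * y + 2 * ccos t).
have H : is_derive x 1 (pow_mean a) (mean (f' x)).
  apply: (@mean_derive _ (fun x t => sqr_dist x t `^ a) f' 0 v
    (`|a| * (((1 - v) ^+ 2) `^ (a - 1) + 10 `^ (a - 1)) * 4)).
  - by rewrite x0.
  - move=> y /andP[y0 yv]; apply: continuous_sqr_dist_powR_lt1; first exact: ltW.
    exact: lt_trans v1.
  - move=> y t /andP[y0 yv]; apply: is_derive_powR_fun; first exact: is_derive_sqr_distl.
    by apply: sqr_dist_gt0; [exact: ltW|exact: lt_trans v1].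
  - move=> y t /andP[y0 yv]; rewrite /f' !normrM.
    have /andP[c1 c2] := ccos_le1 t.
    apply: ler_pM => //; last by rewrite ler_norml; lra.
    apply: ler_wpM2l => //; rewrite ger0_norm ?powR_ge0//.
    apply: powR_bound; first by rewrite exprn_gt0// subr_gt0.
    rewrite sqr_dist_le; last by lra.
    rewrite andbT (le_trans _ (sqr_dist_ge t (ltW y0)))// lerXn2r ?nnegrE; lra.
apply: (is_derive_eq H).
have c1 := @continuous_sqr_dist_powR_lt1 a x (ltW x0) x1.
have c2 := @continuous_sqr_dist_powR_lt1 (a - 1) x (ltW x0) x1.
rewrite /pow_mean -meanZ// -meanB//; last by apply: ctsM => //; exact: cts_cst.
rewrite -meanZ; last by apply: ctsB => //; apply: ctsM => //; exact: cts_cst.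
congr mean; apply/funext => t; rewrite /f'.
have X0 := sqr_dist_gt0 t (ltW x0) x1.
rewrite (powR_pred a X0).
have -> : 2 * x + 2 * ccos t = (sqr_dist x t + x ^+ 2 - 1) / x.
  by rewrite /sqr_dist; field; rewrite gt_eqF.
by field; rewrite gt_eqF.
Qed.

Lemma pow_mean_rec a x : 0 < x < 1 ->
  (a + 1) * pow_mean (a + 1) x - (2 * a + 1) * (1 + x ^+ 2) * pow_mean a x
   + a * (1 - x ^+ 2) ^+ 2 * pow_mean (a - 1) x = 0.
Proof.
move=> /andP[x0 x1].
have c0 := @continuous_sqr_dist_powR_lt1 (a + 1) x (ltW x0) x1.
have c1 := @continuous_sqr_dist_powR_lt1 a x (ltW x0) x1.
have c2 := @continuous_sqr_dist_powR_lt1 (a - 1) x (ltW x0) x1.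
have cM k b : continuous (fun t => sqr_dist x t `^ b) ->
    continuous (fun t => k * sqr_dist x t `^ b).
  by move=> cb; apply: ctsM => //; exact: cts_cst.
have cM0 := cM (a + 1) _ c0.
have cM1 := cM ((2 * a + 1) * (1 + x ^+ 2)) _ c1.
have cM2 := cM (a * (1 - x ^+ 2) ^+ 2) _ c2.
have cB := ctsB cM0 cM1.
rewrite /pow_mean -!meanZ// -meanB// -meanD//.
have dF t : is_derive t 1 (fun t => x / pi * (sqr_dist x t `^ a * csin t))
    ((a + 1) * sqr_dist x t `^ (a + 1)
      - (2 * a + 1) * (1 + x ^+ 2) * sqr_dist x t `^ a
      + a * (1 - x ^+ 2) ^+ 2 * sqr_dist x t `^ (a - 1)).
  have X0 := sqr_dist_gt0 t (ltW x0) x1.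
  apply: (is_derive_eq (is_deriveZ_fun (x / pi) (is_deriveM_fun
    (is_derive_powR_fun a (is_derive_sqr_dist x t) X0) (is_derive_csin t)))).
  rewrite (powR_pred (a + 1) X0) addrK (powR_pred a X0).
  set Y := sqr_dist x t `^ (a - 1).
  have pi0 : pi != 0 :> R by rewrite gt_eqF ?pi_gt0.
  have -> : x / pi * (a * Y * - (4 * pi * x * csin t) * csin t +
      sqr_dist x t * Y * (ccos t * (2 * pi)))
    = Y * (sqr_dist x t * (2 * x * ccos t) - 4 * a * x ^+ 2 * csin t ^+ 2).
    by move: (pi : R) pi0 => P P0; field.
  rewrite ccos_csin /sqr_dist; ring.
rewrite (mean_FTC _ dF); last exact: ctsD.
by rewrite /csin mulr1 mulr0 sin0 mulr_natl sin2pi !mulr0 subrr.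
Qed.

(** Limit of [pow_mean_rec] as x tends to 1: for [1 <= a] all three means are continuous at 1, and
    the last term carries the factor [1 - x ^+ 2]. *)
Lemma pow_mean_rec1 a : 1 <= a ->
  (a + 1) * pow_mean (a + 1) 1 = 2 * (2 * a + 1) * pow_mean a 1.
Proof.
move=> a1.
pose f x := (a + 1) * pow_mean (a + 1) x - (2 * a + 1) * (1 + x ^+ 2) * pow_mean a x
   + a * (1 - x ^+ 2) ^+ 2 * pow_mean (a - 1) x.
have cf : {for 1, continuous f}.
  have i1 : 0 <= (1 : R) <= 1 by rewrite ler01 lexx.
  have c0 := @continuous_pow_mean (a + 1) 1 ltac:(lra) i1.
  have c1 := @continuous_pow_mean a 1 ltac:(lra) i1.
  have c2 := @continuous_pow_mean (a - 1) 1 ltac:(lra) i1.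
  have cX : {for (1 : R), continuous (fun x : R => x ^+ 2)}.
    exact: is_derive_continuous (is_derive_sqr 1).
  have cX' : {for (1 : R), continuous (fun x : R => (1 - x ^+ 2) ^+ 2)}.
    have h : {for (1 : R), continuous (fun x : R => 1 - x ^+ 2)}.
      by apply: cvgB => //; exact: cvg_cst.
    by apply: cvgM.
  apply: cvgD; first apply: cvgB.
  - by apply: cvgM => //; exact: cvg_cst.
  - by apply: cvgM => //; apply: cvgM; [exact: cvg_cst|apply: cvgD => //; exact: cvg_cst].
  - by apply: cvgM => //; apply: cvgM => //; exact: cvg_cst.
have f0 x : 0 < x < 1 -> f x = 0 by exact: pow_mean_rec.
have : f 1 = 0.
  apply/le_anti/andP; split; last first.
    by apply: (continuous_limit_le ltr01 cf) => x /f0->.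
  rewrite -oppr_ge0; apply: (@continuous_limit_le _ (fun x => - f x) 0 1) => //.
    by apply: cvgN.
  by move=> x /f0->; rewrite oppr0.
by rewrite /f !expr1n subrr expr0n /= mulr0 mul0r addr0 => /eqP; rewrite subr_eq0 => /eqP ->; ring.
Qed.

Lemma pow_mean_1_1 : pow_mean 1 1 = 2.
Proof.
rewrite /pow_mean (_ : (fun t => _) = (fun t => 2 + 2 * ccos t)); last first.
  apply/funext => t; rewrite powRr1 ?sqr_dist_ge0// /sqr_dist expr1n mulr1; lra.
have cc := continuous_ccos.
rewrite meanD ?mean_cst ?meanZ ?mean_ccos ?mulr0 ?addr0//; first exact: cts_cst.
by apply: ctsM => //; exact: cts_cst.
Qed.

Lemma pow_mean1_le (a b : R) : 0 <= a -> 0 <= b ->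
  pow_mean (a + b) 1 <= 4 `^ b * pow_mean a 1.
Proof.
move=> a0 b0; have ca := @continuous_sqr_dist_powR a 1 a0.
rewrite /pow_mean -meanZ//; apply: le_mean.
- by apply: continuous_sqr_dist_powR; exact: addr_ge0.
- by apply: ctsM => //; exact: cts_cst.
move=> t; have [->|b0'] := eqVneq b 0; first by rewrite addr0 powRr0 mul1r.
rewrite powRD; last by apply/implyP => /eqP ab; move/eqP: b0' => []; lra.
rewrite mulrC ler_wpM2r ?powR_ge0// ge0_ler_powR// ?nnegrE ?sqr_dist_ge0//.
by rewrite /sqr_dist; have /andP[] := ccos_le1 t; rewrite expr1n; lra.
Qed.

End circle_powers.

(** * The Gamma function *)

Section powR_inequalities.
Context {R : realType}.

Lemma eq_ler (x y : R) : x = y -> x <= y.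
Proof. by move=> ->. Qed.

Lemma powR_tangent (r u v : R) : 1 <= r -> 0 <= u -> 0 <= v ->
  u `^ r + r * u `^ (r - 1) * (v - u) <= v `^ r.
Proof.
rewrite le_eqVlt => /predU1P[<- u0 v0|r1 u0 v0].
  by rewrite subrr powRr0 !mul1r !powRr1// addrC subrK.
have r0 : 0 < r by lra.
have s0 : 0 < r - 1 by lra.
have q0 : 0 < r / (r - 1) by rewrite divr_gt0.
have pq : r^-1 + (r / (r - 1))^-1 = 1 by field; rewrite !gt_eqF.
have := conjugate_powR v0 (powR_ge0 u (r - 1)) r0 q0 pq.
rewrite -powRrM mulrCA mulfV ?gt_eqF// mulr1.
have uu : u `^ r = u * u `^ (r - 1) by rewrite mulr_powRB1.
move=> H; have := ler_wpM2l (ltW r0) H.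
have -> : r * (v `^ r / r + u `^ r / (r / (r - 1))) = v `^ r + (r - 1) * u `^ r.
  by field; rewrite !gt_eqF.
rewrite uu -subr_ge0 => H2; rewrite -subr_ge0; apply: le_trans H2 _.
by apply: eq_ler; ring.
Qed.

Lemma powR_tangent_concave (s l t : R) : 0 <= s -> s <= 1 -> 0 < l -> 0 <= t ->
  t `^ s <= l `^ s * (1 - s + s * (t / l)).
Proof.
rewrite le_eqVlt => /predU1P[<- _ _ _|s0 s1 l0 t0].
  by rewrite !powRr0 subr0 mul0r addr0 mul1r.
have r1 : 1 <= s^-1 by rewrite -[leLHS]invr1 lef_pV2 ?posrE.
have := powR_tangent r1 (powR_ge0 l s) (powR_ge0 t s).
have e1 : s * s^-1 = 1 by rewrite mulfV// gt_eqF.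
have e2 : s * (s^-1 - 1) = 1 - s by rewrite mulrBr e1 mulr1.
rewrite -(powRrM l s s^-1) -(powRrM l s (s^-1 - 1)) -(powRrM t s s^-1) e1 e2.
rewrite !powRr1 ?(ltW l0)//.
have -> : l `^ (1 - s) = l / l `^ s.
  by rewrite powRB ?powRr1 ?(ltW l0)// (gt_eqF l0) implybT.
have p0 : 0 < l `^ s by rewrite powR_gt0.
move=> H; have := ler_wpM2l (ltW (mulr_gt0 s0 (divr_gt0 p0 l0))) H.
rewrite -subr_ge0 => H2; rewrite -subr_ge0; apply: le_trans H2 _.
by apply: eq_ler; field; rewrite !gt_eqF.
Qed.

End powR_inequalities.

Section Gamma.
Context {R : realType}.
Implicit Types a t x : R.
Local Notation mu := (@lebesgue_measure R).

Let w a t := `|t| `^ a * expR (- t).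

Let cw a : 0 <= a -> continuous (w a).
Proof.
move=> a0; apply: ctsM.
  apply: cts_powR => //; first by move=> x; exact: norm_continuous.
have cN : continuous (fun t : R => - t) by move=> t; apply: cvgN; exact: cvg_id.
exact: (cts_comp cN (@continuous_expR R)).
Qed.

Let halfexp t := expR (- (2^-1 * t)).

Let dhalfexp t : is_derive t 1 halfexp (- (2^-1) * halfexp t).
Proof.
apply: (is_derive_eq (is_derive1_comp (is_derive_expR _)
  (is_deriveN_fun (is_deriveZ_fun 2^-1 (is_derive_idr t))))).
by rewrite mulr1 mulrC.
Qed.

Let chalfexp : continuous halfexp.
Proof. by move=> t; exact: is_derive_continuous (dhalfexp t). Qed.

Let halfexp_cvg : halfexp t @[t --> +oo] --> 0.
Proof.
apply: (@cvg_comp _ _ _ (fun t : R => 2^-1 * t) (fun t => expR (- t))); last exact: cvgr_expR.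
by apply: gt0_cvgMry => //; rewrite invr_gt0.
Qed.

Let w_le a : 0 <= a -> exists2 C, 0 <= C & forall t, 0 <= t -> w a t <= C * halfexp t.
Proof.
rewrite le_eqVlt => /predU1P[<-|a0].
  exists 1 => // t t0; rewrite /w powRr0 !mul1r ler_expR; lra.
(* The constant comes from raising [t / (2 * a) <= expR (t / (2 * a))] to the power [a], which
   leaves [expR (t / 2)] on the right. *)
exists ((2 * a) `^ a); first exact: powR_ge0.
move=> t t0; rewrite /w ger0_norm//.
have -> : expR (- t) = expR (- (2^-1 * t)) * expR (- (2^-1 * t)).
  by rewrite -expRD; congr expR; lra.
rewrite mulrA; apply: ler_wpM2r; first exact: expR_ge0.
have ta : 0 <= t / (2 * a) by rewrite divr_ge0// mulr_ge0// ltW.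
have -> : t `^ a = (2 * a) `^ a * (t / (2 * a)) `^ a.
  have a2 : 0 <= 2 * a by lra.
  by rewrite -powRM// mulrCA mulfV ?mulr1//; rewrite gt_eqF//; lra.
rewrite -mulrA ler_piMr ?powR_ge0//.
have h : t / (2 * a) <= expR (t / (2 * a)).
  by have := expR_ge1Dx (t / (2 * a)); lra.
have : (t / (2 * a)) `^ a <= expR (t / (2 * a)) `^ a.
  by rewrite ge0_ler_powR// ?nnegrE ?expR_ge0// ltW.
rewrite -expRM => h2.
have e1 : expR (2^-1 * t) * expR (- (2^-1 * t)) = 1 by rewrite -expRD subrr expR0.
rewrite -[leRHS]e1 ler_wpM2r ?expR_ge0//.
by rewrite (le_trans h2)// ler_expR; apply: eq_ler; field; rewrite gt_eqF.
Qed.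

Let mI : measurable (`[0%R, +oo[%classic : set (measurableTypeR R)).
Proof. exact: measurable_itv. Qed.

Let eint_halfexp : (\int[mu]_(t in `[0%R, +oo[) (2^-1 * halfexp t)%:E)%E = 1%:E.
Proof.
have dh t := is_deriveN_fun (dhalfexp t).
rewrite (@ge0_continuous_FTC2y R _ (fun t => - halfexp t) 0 0).
- by rewrite /halfexp mulr0 oppr0 expR0 -EFinB opprK add0r.
- by move=> x _; rewrite mulr_ge0 ?expR_ge0// invr_ge0.
- by apply: continuous_within; apply: ctsM; [exact: cts_cst|exact: chalfexp].
- by rewrite -oppr0; apply: cvgN; exact: halfexp_cvg.
- by move=> x _; have h := dh x; exact: ex_derive.
- by apply: cvg_at_right_filter; apply: is_derive_continuous (dh 0).
- by move=> x _; rewrite (is_derive1E (dh x)) mulNr opprK.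
Qed.

Let int_halfexp : \int[mu]_(t in `[0, +oo[) (2^-1 * halfexp t) = 1.
Proof. by rewrite /Rintegral eint_halfexp. Qed.

Let cts_measurable (f : R -> R) : continuous f ->
  measurable_fun (`[0%R, +oo[%classic : set R) f.
Proof.
move=> cf; apply: measurable_funTS.
exact: continuous_measurable_fun.
Qed.

Let integrable_halfexp c : mu.-integrable `[0, +oo[ (EFin \o (fun t => c * halfexp t)).
Proof.
have H : mu.-integrable `[0, +oo[ (EFin \o (fun t => 2^-1 * halfexp t)).
  apply/integrableP; split.
    by apply/measurable_EFinP; apply: cts_measurable; apply: ctsM; [exact: cts_cst|exact: chalfexp].
  under eq_integral => t _ do rewrite /= ger0_norm ?mulr_ge0 ?expR_ge0 ?invr_ge0//.
  by rewrite eint_halfexp ltry.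
have := integrableZl mI (2 * c) H.
apply: eq_integrable => // t _; rewrite /= -EFinM; congr EFin.
by rewrite mulrA; congr (_ * _); field.
Qed.

Let integrable_w a : 0 <= a -> mu.-integrable `[0, +oo[ (EFin \o w a).
Proof.
move=> a0; have [C C0 wC] := w_le a0.
apply: (le_integrable mI _ _ (integrable_halfexp C)).
  by apply/measurable_EFinP; exact: cts_measurable (cw a0).
move=> t; rewrite /= in_itv/= andbT => t0; rewrite lee_fin !ger0_norm ?wC//.
  by rewrite mulr_ge0// expR_ge0.
by rewrite mulr_ge0 ?powR_ge0 ?expR_ge0.
Qed.

Let I a := \int[mu]_(t in `[0, +oo[) w a t.

Let GammaE x : 1 <= x -> Gamma x = I (x - 1).
Proof.
move=> x1; have x0 : 0 <= x - 1 by lra.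
rewrite /I -Rintegral_itv_obnd_cbnd; last first.
  apply: (integrableS mI _ _ (integrable_w x0)) => // t /=.
  by rewrite !in_itv/= !andbT => /ltW.
apply: eq_Rintegral => t; rewrite inE/= in_itv/= andbT => t0.
by rewrite /w ger0_norm// ltW.
Qed.

Let I0 : I 0 = 1.
Proof.
have dE t : is_derive t 1 (fun t => - expR (- t)) (w 0 t).
  apply: (is_derive_eq (is_deriveN_fun (is_derive1_comp (is_derive_expR _)
    (is_deriveN_fun (is_derive_idr t))))).
  by rewrite /w powRr0 mul1r mulrN1 opprK.
rewrite /I (@Rintegral_ge0_continuous_FTC2y R _ (fun t => - expR (- t)) 0 0).
- by rewrite oppr0 expR0 opprK add0r.
- by move=> t _; rewrite mulr_ge0 ?powR_ge0 ?expR_ge0.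
- by apply: continuous_within; exact: cw.
- by rewrite -oppr0; apply: cvgN; exact: cvgr_expR.
- by move=> t _; have h := dE t; exact: ex_derive.
- by apply: cvg_at_right_filter; apply: is_derive_continuous (dE 0).
- by move=> t _; rewrite (is_derive1E (dE t)).
Qed.

Let I_rec a : 0 <= a -> I (a + 1) = (a + 1) * I a.
Proof.
move=> a0; have a1 : 0 <= a + 1 by lra.
have [C C0 wC] := w_le a0; have [C1 C10 wC1] := w_le a1.
pose K := (a + 1) * C.
have K0 : 0 <= K by rewrite mulr_ge0.
(* Integration by parts, with [K * halfexp] added to make the integrand nonnegative, as the
   fundamental theorem on the half-line is applied in its nonnegative form. The added term has
   integral [2 * K], which is subtracted at the end. *)
pose f t := w (a + 1) t - (a + 1) * w a t + K * halfexp t.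
pose F t := - (w (a + 1) t) - 2 * K * halfexp t.
have cf : continuous f.
  apply: ctsD; last by apply: ctsM; [exact: cts_cst|exact: chalfexp].
  by apply: ctsB; [exact: cw|apply: ctsM; [exact: cts_cst|exact: cw]].
have cF : continuous F.
  apply: ctsB; last by apply: ctsM; [exact: cts_cst|exact: chalfexp].
  by move=> t; apply: cvgN; exact: cw.
have f0 t : 0 <= t -> 0 <= f t.
  move=> t0; have a10 : 0 <= a + 1 by lra.
  have : (a + 1) * w a t <= K * halfexp t by rewrite /K -mulrA ler_wpM2l ?wC.
  rewrite /f; have : 0 <= w (a + 1) t by rewrite mulr_ge0 ?powR_ge0 ?expR_ge0.
  lra.
have dF t : 0 < t -> is_derive t 1 F (f t).
  move=> t0.
  have h : is_derive t 1 (fun t => t `^ (a + 1) * expR (- t))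
      ((a + 1) * t `^ a * expR (- t) - t `^ (a + 1) * expR (- t)).
    apply: (is_derive_eq (is_deriveM_fun (is_derive1_powR (a + 1) t0)
      (is_derive1_comp (is_derive_expR _) (is_deriveN_fun (is_derive_idr t))))).
    by rewrite addrK mulrN1 mulrN.
  have h' : is_derive t 1 (w (a + 1))
      ((a + 1) * t `^ a * expR (- t) - t `^ (a + 1) * expR (- t)).
    apply: near_eq_is_derive h.
    by near=> y; rewrite /w ger0_norm//; apply: ltW; near: y; exact: lt_nbhsr.
  apply: (is_derive_eq (is_deriveB_fun (is_deriveN_fun h')
    (is_deriveZ_fun (2 * K) (dhalfexp t)))).
  by rewrite /f /w (ger0_norm (ltW t0)); field.
have int_f : \int[mu]_(t in `[0, +oo[) f t = 2 * K.
  rewrite (@Rintegral_ge0_continuous_FTC2y R _ F 0 0).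
  - rewrite /F /w normr0 powR0 ?gt_eqF//; last by lra.
    by rewrite mul0r oppr0 !add0r opprK /halfexp mulr0 oppr0 expR0 mulr1.
  - exact: f0.
  - exact: continuous_within.
  - have h0 : 2 * K * halfexp t @[t --> +oo] --> 0.
      by rewrite -(mulr0 (2 * K)); apply: cvgM; [exact: cvg_cst|exact: halfexp_cvg].
    have h1 : w (a + 1) t @[t --> +oo] --> 0.
      apply: (@squeeze_cvgr _ _ _ _ (fun=> 0) (fun t => C1 * halfexp t)).
      + near=> t; rewrite wC1 ?andbT; last by near: t; exact: nbhs_pinfty_ge.
        by rewrite mulr_ge0 ?powR_ge0 ?expR_ge0.
      + exact: cvg_cst.
      + by rewrite -(mulr0 C1); apply: cvgM; [exact: cvg_cst|exact: halfexp_cvg].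
    by rewrite -oppr0 -(subr0 (- 0)); apply: cvgB => //; exact: cvgN.
  - by move=> t /dF h; exact: ex_derive.
  - by apply: cvg_at_right_filter; exact: cF.
  - by move=> t; rewrite in_itv/= andbT => t0; rewrite (is_derive1E (dF t t0)).
have iw := integrable_w a0; have iw1 := integrable_w a1.
have iw' := integrableZl mI (a + 1) iw.
have ih := integrable_halfexp K.
move: int_f; rewrite /f RintegralD//; last exact: (integrableB mI iw1 iw').
rewrite RintegralB// RintegralZl//.
have -> : \int[mu]_(t in `[0, +oo[) (K * halfexp t) = 2 * K.
  have i2 := integrable_halfexp 2^-1.
  transitivity (2 * K * \int[mu]_(t in `[0, +oo[) (2^-1 * halfexp t)).
    by rewrite -RintegralZl//; apply: eq_Rintegral => t _; field.
  by rewrite int_halfexp mulr1.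
by rewrite /I; lra.
Unshelve. all: end_near. Qed.

Lemma Gamma1 : @Gamma R 1 = 1.
Proof. by rewrite GammaE// subrr I0. Qed.

Lemma GammaS x : 1 <= x -> Gamma (x + 1) = x * Gamma x.
Proof.
move=> x1; rewrite !GammaE//; last by lra.
by rewrite addrK; have := @I_rec (x - 1) ltac:(lra); rewrite subrK.
Qed.

(** Jensen's inequality for the concave power [s] under the density proportional to t^(x-1) e^-t:
    its mean is [x], so the tangent is taken at [x], and [I_rec] evaluates the linear term. *)
Lemma le_GammaD x s : 1 <= x -> 0 <= s -> s <= 1 -> Gamma (x + s) <= x `^ s * Gamma x.
Proof.
move=> x1 s0 s1; have x0 : 0 < x by lra.
have a0 : 0 <= x - 1 by lra.
have iw := integrable_w a0; have iw1 := @integrable_w (x - 1 + 1) ltac:(lra).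
have iw' := integrableZl mI (x `^ s * (1 - s)) iw.
have iw1' := integrableZl mI (x `^ s * (s / x)) iw1.
have -> : x `^ s * Gamma x =
    x `^ s * (1 - s) * I (x - 1) + x `^ s * (s / x) * I (x - 1 + 1).
  by rewrite I_rec// subrK GammaE//; field; rewrite gt_eqF.
rewrite GammaE; last by lra.
rewrite /I -!RintegralZl// -RintegralD//; apply: le_Rintegral => //.
- by apply: integrable_w; lra.
- exact: (integrableD mI iw' iw1').
move=> t; rewrite /= in_itv/= andbT => t0; rewrite /w ger0_norm//.
have [->|tn0] := eqVneq t 0.
  (* A zero power of 0 is 1, so at t = 0 the vanishing exponent, which forces [x = 1] and [s = 0],
     is treated apart. *)
  have [xs|xs] := eqVneq (x + s - 1) 0.
    have -> : s = 0 by lra.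
    have -> : x = 1 by lra.
    by rewrite addr0 subrr !powRr0 subr0 !mul0r mulr0 mul0r addr0 !mul1r.
  rewrite powR0// mul0r addr_ge0// !mulr_ge0 ?powR_ge0 ?expR_ge0 ?invr_ge0//; lra.
have tp : 0 < t by rewrite lt_neqAle eq_sym tn0.
rewrite (_ : x + s - 1 = s + (x - 1)); last by lra.
have E r : t `^ (r + (x - 1)) = t `^ r * t `^ (x - 1) by rewrite powRD// tn0 implybT.
rewrite E (addrC (x - 1)) E powRr1//.
have := ler_wpM2r (mulr_ge0 (powR_ge0 t (x - 1)) (expR_ge0 (- t)))
  (powR_tangent_concave s0 s1 x0 t0).
rewrite mulrA => /le_trans; apply; apply: eq_ler; field; rewrite gt_eqF//.
Qed.

(** Jensen's inequality for the power [1 + a], which is convex for every [a >= 0], unlike the power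
    [a]. The density is therefore proportional to t^(y-2) e^-t, whose mean is [y - 1]; hence the
    base [y - 1] and the bound [2 <= y]. *)
Lemma ge_GammaD y a : 2 <= y -> 0 <= a -> Gamma y * (y - 1) `^ a <= Gamma (y + a).
Proof.
move=> y2 a0; have l0 : 0 < y - 1 by lra.
have b0 : 0 <= y - 2 by lra.
have iw := integrable_w b0; have iw1 := @integrable_w (y - 2 + 1) ltac:(lra).
pose l := y - 1.
have iw' := integrableZl mI (l `^ (1 + a) - (1 + a) * l `^ a * l) iw.
have iw1' := integrableZl mI ((1 + a) * l `^ a) iw1.
have la : l `^ (1 + a) = l * l `^ a.
  by rewrite powRD ?powRr1 ?(ltW l0)// /l (gt_eqF l0) implybT.
have -> : Gamma y * l `^ a =
    (l `^ (1 + a) - (1 + a) * l `^ a * l) * I (y - 2) + (1 + a) * l `^ a * I (y - 2 + 1).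
  rewrite la GammaE; last by lra.
  rewrite (_ : y - 1 = y - 2 + 1); last by lra.
  by rewrite I_rec// /l; ring.
rewrite GammaE; last by lra.
rewrite /I -!RintegralZl// -RintegralD//; apply: le_Rintegral => //.
- exact: (integrableD mI iw' iw1').
- by apply: integrable_w; lra.
move=> t; rewrite /= in_itv/= andbT => t0; rewrite /w ger0_norm//.
have [->|tn0] := eqVneq t 0.
  have p1 : y + a - 1 != 0 by rewrite gt_eqF//; lra.
  have p2 : y - 2 + 1 != 0 by rewrite gt_eqF//; lra.
  rewrite (powR0 p1) (powR0 p2) mul0r mulr0 addr0.
  rewrite la (_ : _ - _ = - (a * l * l `^ a)); last by ring.
  by rewrite mulNr oppr_le0 !mulr_ge0 ?powR_ge0 ?expR_ge0// ltW.
have tp : 0 < t by rewrite lt_neqAle eq_sym tn0.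
rewrite (_ : y + a - 1 = (1 + a) + (y - 2)); last by lra.
have E r : t `^ (r + (y - 2)) = t `^ r * t `^ (y - 2) by rewrite powRD// tn0 implybT.
rewrite E (addrC (y - 2)) E powRr1//.
have a1 : 1 <= 1 + a by lra.
have H := ler_wpM2r (mulr_ge0 (powR_ge0 t (y - 2)) (expR_ge0 (- t)))
  (powR_tangent a1 (ltW l0) t0).
apply: le_trans (le_trans _ H) _; apply: eq_ler; last by rewrite mulrA.
by rewrite (_ : 1 + a - 1 = a); [rewrite -/l; ring|lra].
Qed.

Lemma Gamma_gt0 x : 2 <= x -> 0 < Gamma x.
Proof.
move=> x2; have := @ge_GammaD 2 (x - 2) (lexx _) ltac:(lra).
rewrite (_ : 2 - 1 = 1 :> R) ?powR1 ?mulr1; last by lra.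
rewrite (_ : 2 + (x - 2) = x); last by lra.
by apply: lt_le_trans; rewrite -[2]/(1 + 1) GammaS// Gamma1 mulr1.
Qed.

End Gamma.

(** * Comparison of the mean at x = 1 with the central binomial coefficient *)

Section periodic_ratio.
Context {R : realType} (G g : R -> R).
Implicit Types a s x y : R.
Context (G1 : G 1 = 1) (GS : forall x, 1 <= x -> G (x + 1) = x * G x)
  (G_le : forall x s, 1 <= x -> 0 <= s -> s <= 1 -> G (x + s) <= x `^ s * G x)
  (G_ge : forall y a, 2 <= y -> 0 <= a -> G y * (y - 1) `^ a <= G (y + a))
  (G_gt0 : forall x, 2 <= x -> 0 < G x)
  (g1 : g 1 = 2) (g_ge0 : forall a, 0 <= g a)
  (gS : forall a, 1 <= a -> (a + 1) * g (a + 1) = 2 * (2 * a + 1) * g a)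
  (g_le : forall a b, 0 <= a -> 0 <= b -> g (a + b) <= 4 `^ b * g a).

(* [rho] is 1-periodic and equal to 1 at the positive integers; the bounds on [G] and [g]
   squeeze [rho (n + s)] as [n] grows. *)
Let rho a := g a * G (a + 1) ^+ 2 / G (2 * a + 1).

Let rhoS a : 1 <= a -> rho (a + 1) = rho a.
Proof.
move=> a1; rewrite /rho (@GS (a + 1)); last by lra.
rewrite (_ : 2 * (a + 1) + 1 = 2 * a + 1 + 1 + 1); last by lra.
rewrite (@GS (2 * a + 1 + 1)) ?(@GS (2 * a + 1)); [|by lra..].
have G0 : 0 < G (2 * a + 1) by apply: G_gt0; lra.
have ap : a + 1 != 0 by rewrite gt_eqF//; lra.
have -> : g (a + 1) = 2 * (2 * a + 1) * g a / (a + 1).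
  by rewrite -gS// mulrC mulKf.
field.
by rewrite (gt_eqF G0) !gt_eqF//=; lra.
Qed.

Let rhoDn a n : 1 <= a -> rho (a + n%:R) = rho a.
Proof.
move=> a1; elim: n => [|n IHn]; first by rewrite addr0.
rewrite -natr1 addrA rhoS ?IHn//.
by have : 0 <= n%:R :> R by []; lra.
Qed.

Let rho_nat n : rho n.+1%:R = 1.
Proof.
rewrite -nat1r rhoDn// /rho g1 mulr1 -[2]/(1 + 1) (@GS (1 + 1)); last by lra.
by rewrite GS// G1; field.
Qed.

(** Bounding the numerator of [rho (m + s)] above and its denominator below replaces [rho m] by
    [rho m] times 4^s (m+1)^(2s) / (2m)^(2s) = ((m+1)/m)^(2s); the exponent is at most 2. *)
Let rho_le m s : 1 <= m -> rho m = 1 -> 0 <= s -> s <= 1 ->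
  rho (m + s) <= ((m + 1) / m) ^+ 2.
Proof.
move=> m1 r1 s0 s1; have m0 : 0 < m by lra.
have Gm1 : 0 < G (m + 1) by apply: G_gt0; lra.
have G2 : 0 < G (2 * m + 1) by apply: G_gt0; lra.
have G3 : 0 < G (2 * (m + s) + 1) by apply: G_gt0; lra.
have G4 : 0 < G (m + s + 1) by apply: G_gt0; lra.
have h1 := @g_le m s (ltW m0) s0.
have h2 := @G_le (m + 1) s ltac:(lra) s0 s1.
have h3 := @G_ge (2 * m + 1) (2 * s) ltac:(lra) ltac:(lra).
have Pm : 0 < g m.
  rewrite lt_neqAle g_ge0 andbT.
  by apply/eqP => P0; move: r1; rewrite /rho -P0 !mul0r => /eqP; rewrite eq_sym oner_eq0.
rewrite /rho.
have A : g (m + s) * G (m + s + 1) ^+ 2 <=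
    (4 `^ s * g m) * ((m + 1) `^ s * G (m + 1)) ^+ 2.
  apply: (ler_pM (g_ge0 _) (sqr_ge0 _) h1).
  rewrite lerXn2r ?nnegrE ?(ltW G4)//; last by rewrite (addrAC m s).
  by rewrite mulr_ge0 ?powR_ge0 ?ltW.
have B : (4 `^ s * g m) * ((m + 1) `^ s * G (m + 1)) ^+ 2 =
    G (2 * m + 1) * (2 * m) `^ (2 * s) * ((m + 1) / m) `^ (s * 2).
  have e1 : g m * G (m + 1) ^+ 2 = G (2 * m + 1).
    by have := congr1 (fun z => z * G (2 * m + 1)) r1; rewrite /rho /= divfK ?gt_eqF// mul1r.
  have QM : ((m + 1) / m) `^ s * m `^ s = (m + 1) `^ s.
    have mm0 : 0 <= (m + 1) / m by apply: divr_ge0; lra.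
    by rewrite -powRM ?(ltW m0)// divfK// gt_eqF.
  have e4 : (2 * m) `^ (2 * s) = 4 `^ s * (m `^ s) ^+ 2.
    rewrite (powRrM _ 2) powR_mulrn; last by lra.
    rewrite exprMn powRM ?exprn_ge0//; last by lra.
    rewrite (_ : 2 ^+ 2 = 4 :> R); last by ring.
    by congr (_ * _); rewrite !expr2 powRM ?ltW.
  by rewrite (powRrM _ s 2) powR_mulrn ?powR_ge0// e4 -e1 -QM; ring.
have C0 : 0 < G (2 * m + 1) * (2 * m) `^ (2 * s).
  by rewrite mulr_gt0// powR_gt0//; lra.
rewrite ler_pdivrMr//; apply: le_trans A _; rewrite B.
have h4 : G (2 * m + 1) * (2 * m) `^ (2 * s) <= G (2 * (m + s) + 1).
  move: h3; rewrite addrK (_ : 2 * m + 1 + 2 * s = 2 * (m + s) + 1)//; lra.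
rewrite mulrC; apply: ler_pM; rewrite ?powR_ge0 ?(ltW C0)//.
have mm : 1 <= (m + 1) / m by rewrite ler_pdivlMr// mul1r; lra.
rewrite -powR_mulrn; last by lra.
by rewrite ler_powR//; lra.
Qed.

Lemma periodic_ratio_le a : 1 <= a -> g a * G (a + 1) ^+ 2 <= G (2 * a + 1).
Proof.
move=> a1; have Ga : 0 < G (2 * a + 1) by apply: G_gt0; lra.
suff r1 : rho a <= 1 by move: r1; rewrite /rho ler_pdivrMr// mul1r.
have a0 : 0 <= a by lra.
pose n := Num.truncn a; pose s := a - n%:R.
have /andP[na an] : n%:R <= a < n.+1%:R := truncn_itv a0.
have n1 : (0 < n)%N by rewrite truncn_gt0.
have sn : 0 <= s <= 1 by move: an; rewrite -natr1 /s; lra.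
have H m : rho a <= ((n + m).+1%:R / (n + m)%:R) ^+ 2.
  rewrite -(@rhoDn a m a1) (_ : a + m%:R = (n + m)%:R + s); last by rewrite natrD /s; lra.
  case: n n1 {na an} @s sn => // n' _ s sn; rewrite addSn.
  rewrite -[X in X / _]natr1; move: sn => /andP[s0 s1]; apply: (rho_le _ (rho_nat _) s0 s1).
  by rewrite ler1n.
rewrite leNgt; apply/negP => r1.
(* With z = 1/N one has (1 + z)^2 <= 1 + 3 z, so N > 3 / (rho a - 1) contradicts the bound [H m]. *)
pose m := Num.bound (3 / (rho a - 1)).
have := H m; set N := (n + m)%N.
have N1 : 1 <= N%:R :> R by rewrite ler1n addn_gt0 n1.
have mN : 3 / (rho a - 1) < N%:R.
  have : 3 / (rho a - 1) < m%:R.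
    by apply: archi_boundP; rewrite divr_ge0// subr_ge0 ltW.
  by move=> /lt_le_trans; apply; rewrite ler_nat leq_addl.
move: mN; rewrite ltr_pdivrMr ?subr_gt0// => mN.
rewrite -natr1 leNgt => /negP; apply.
have -> : (N%:R + 1) / N%:R = 1 + N%:R^-1 :> R by field; rewrite gt_eqF//; lra.
set z := N%:R^-1.
have z0 : 0 < z by rewrite invr_gt0; lra.
have z1 : z <= 1 by rewrite invf_le1//; lra.
have zN : z * N%:R = 1 by rewrite mulVf// gt_eqF//; lra.
have : 3 * z < rho a - 1.
  by rewrite -(ltr_pM2r (x := N%:R)) -?mulrA ?zN ?mulr1; lra.
have : z ^+ 2 <= z by rewrite expr2 ler_piMr// ltW.
by rewrite sqrrD expr1n; lra.
Qed.

End periodic_ratio.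


Lemma pow_mean_le_central (R : realType) (a : R) : 1 <= a ->
  pow_mean a 1 <= central_binomial (2 * a).
Proof.
move=> a1; have ga : 0 < Gamma (a + 1) by apply: Gamma_gt0; lra.
have H : pow_mean a 1 * Gamma (a + 1) ^+ 2 <= Gamma (2 * a + 1).
  pose G (x : R) := Gamma x; pose g b := @pow_mean R b 1.
  have h := @periodic_ratio_le R G g.
  have {}h := h (@Gamma1 R) (@GammaS R).
  have {}h := h (@le_GammaD R).
  have {}h := h (@ge_GammaD R) (@Gamma_gt0 R).
  have {}h := h (@pow_mean_1_1 R) (pow_mean_ge0 ^~ 1).
  have {}h := h (@pow_mean_rec1 R).
  have {}h := h (@pow_mean1_le R).
  exact: h.

rewrite /central_binomial (_ : 2 * a / 2 = a); last by field.
by rewrite ler_pdivlMr ?exprn_gt0.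
Qed.

(** * The linear two-point inequality *)

Section sign_function.
Context {R : realType} (p q : R).
Context (p1 : 1 < p) (p2 : p < 2) (q2 : 2 < q).

Let b := p / 2.
Let q0 : 0 <= q. Proof. by move: p1 p2 q2; lra. Qed.
Let b0 : 0 <= b. Proof. by rewrite /b; move: p1 p2; lra. Qed.
Let b1 : 0 <= 1 - b. Proof. by rewrite /b; move: p1 p2; lra. Qed.
Let b2 : - b - 1 <= b - 2. Proof. by rewrite /b; move: p1 p2; lra. Qed.

Let e (y : R) := p * (1 - y) - q * (y `^ (1 - b) - y `^ b).
Let e' (y : R) := - p - q * ((1 - b) * y `^ (- b) - b * y `^ (b - 1)).

Let de (y : R) : 0 < y -> is_derive y 1 e (e' y).
Proof.
move=> y0.
apply: (is_derive_eq (is_deriveB_fun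
  (is_deriveZ_fun p (is_deriveB_fun (is_derive_cstr 1 y) (is_derive_idr y)))
  (is_deriveZ_fun q (is_deriveB_fun (is_derive1_powR (1 - b) y0) (is_derive1_powR b y0))))).
rewrite /e' (_ : 1 - b - 1 = - b); last by ring.
by rewrite sub0r mulrN1.
Qed.

Let de' (y : R) : 0 < y ->
  is_derive y 1 e' (q * b * (1 - b) * (y `^ (- b - 1) - y `^ (b - 2))).
Proof.
move=> y0.
apply: (is_derive_eq (is_deriveB_fun (is_derive_cstr (- p) y)
  (is_deriveZ_fun q (is_deriveB_fun (is_deriveZ_fun (1 - b) (is_derive1_powR (- b) y0))
    (is_deriveZ_fun b (is_derive1_powR (b - 1) y0)))))).
by rewrite (_ : b - 1 - 1 = b - 2); ring.
Qed.

(** On ]0, 1] the larger exponent gives the smaller power, so the second derivative is nonnegative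
    as soon as [- b - 1 <= b - 2], which says [1 <= p]; the factor [1 - b] is nonnegative because
    [p < 2]. *)
Let e'_ndecr (y z : R) : 0 < y -> y <= z -> z <= 1 -> e' y <= e' z.
Proof.
move=> y0 yz z1.
have ce : {within `[y, z], continuous e'}.
  apply: continuous_in_subspaceT => u; rewrite inE/= in_itv/= => /andP[yu _].
  by apply: (is_derive_continuous (de' _)); exact: lt_le_trans yu.
have dE (u : R) : y < u < z -> is_derive u 1 e'
    (q * b * (1 - b) * (u `^ (- b - 1) - u `^ (b - 2))).
  by move=> /andP[yu _]; apply: de'; exact: lt_trans yu.
apply: (is_derive_ndecr ce dE _ (lexx y) yz (lexx z)).
move=> u /andP[yu uz]; apply: mulr_ge0.
  exact: (mulr_ge0 (mulr_ge0 q0 b0) b1).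
rewrite subr_ge0; apply: ger_powR => //.
by rewrite (lt_trans y0)//= ltW// (lt_le_trans uz).
Qed.

Let e1 : e 1 = 0.
Proof. by rewrite /e !powR1 !subrr !mulr0 subrr. Qed.

(* [e] is convex with [e 1 = 0]. *)
Let e_neg (z x : R) : 0 < z -> z < x -> x < 1 -> e z < 0 -> e x < 0.
Proof.
move=> z0 zx x1 ez; rewrite ltNge; apply/negP => ex.
have x0 := lt_trans z0 zx.
have ce u v : 0 < u -> {within `[u, v], continuous e}.
  move=> u0; apply: continuous_in_subspaceT => w; rewrite inE/= in_itv/= => /andP[uw _].
  by apply: (is_derive_continuous (de _)); exact: lt_le_trans uw.
have dez u : u \in `]z, x[%R -> is_derive u 1 e (e' u).
  by rewrite in_itv/= => /andP[zu _]; apply: de; exact: lt_trans zu.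
have dex u : u \in `]x, 1[%R -> is_derive u 1 e (e' u).
  by rewrite in_itv/= => /andP[xu _]; apply: de; exact: lt_trans xu.
have [c /andP[zc cx] c'] := MVT zx dez (ce z x z0).
have [d /andP[xd d1] d'] := MVT x1 dex (ce x 1 x0).
rewrite !bnd_simp in zc cx xd d1.
have c0 : 0 < e' c.
  by rewrite -(pmulr_lgt0 _ (_ : 0 < x - z)) ?subr_gt0// -c'; lra.
have : e' d <= 0.
  by rewrite -(pmulr_lle0 _ (_ : 0 < 1 - x)) ?subr_gt0// -d' e1; lra.
have := @e'_ndecr c d (lt_trans z0 zc) (ltW (lt_trans cx xd)) (ltW d1).
by lra.
Qed.

(** Up to a nonnegative factor, its opposite is the derivative of the Wronskian [W] below. In the
    variable [x ^+ 2] it is the convex function [e]. *)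
Definition sign_fun (x : R) := p * (1 - x ^+ 2) - q * (x `^ (2 - p) - x `^ p).

Lemma sign_fun_lt0 (z x : R) : 0 < z -> z < x -> x < 1 ->
  sign_fun z < 0 -> sign_fun x < 0.
Proof.
have E y : 0 < y -> sign_fun y = e (y ^+ 2).
  move=> y0; rewrite /sign_fun /e -!(powR_mulrn 2 (ltW y0)) -!powRrM.
  have -> : 2 * b = p by rewrite /b; field.
  by have -> : 2 * (1 - b) = 2 - p by rewrite /b; field.
move=> z0 zx x1; have x0 := lt_trans z0 zx; rewrite !E//; apply: e_neg.
- by rewrite exprn_gt0.
- by rewrite ltrXn2r// ltW.
- by rewrite expr_lt1// ltW.
Qed.

End sign_function.

(** * Sturm comparison for the quotient on [0, 1] *)

Section two_point_unit.
Context {R : realType} (p q : R).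
Context (p1 : 1 < p) (p2 : p < 2) (q2 : 2 < q).
Implicit Types x : R.

Let Y x := `|x| `^ p.
Let T x := Y x / (1 + Y x).
Let U x := pow_mean (q / 2) x.
Let V x := pow_mean (q / 2 - 1) x.
(* [S = x r' / (q N)], and the factor [Phi] turns it into a Wronskian [W] of
   [U] and [(1 + Y) `^ (q / p)]: since [U] solves a hypergeometric equation,
   [W'] has the sign of [- E], see [dW] and [dr]. *)
Let S x := (1 / 2 - T x) * U x - (1 - x ^+ 2) / 2 * V x.
Let Phi x := (1 + Y x) `^ (q / p) * (1 - x ^+ 2) `^ (- q).
Let W x := Phi x * S x.
Let N x := (1 + Y x) `^ (- (q / p)).
Let r x := U x * N x.
Let E := sign_fun p q.

Let p0 : 0 < p. Proof. by move: p1 p2 q2; lra. Qed.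
Let q0 : 0 < q. Proof. by move: p1 p2 q2; lra. Qed.

Let Y_ge0 x : 0 <= Y x. Proof. exact: powR_ge0. Qed.
Let Y1_gt0 x : 0 < 1 + Y x. Proof. by rewrite ltr_pwDl. Qed.

Let dY x : 0 < x -> is_derive x 1 Y (p * Y x / x).
Proof.
move=> x0.
have h : is_derive x 1 (fun y => y `^ p) (p * Y x / x).
  apply: (is_derive_eq (is_derive1_powR p x0)).
  by rewrite /Y ger0_norm ?ltW// (powR_pred p x0); field; rewrite gt_eqF.
apply: near_eq_is_derive h.
by near=> y; rewrite /Y ger0_norm//; apply: ltW; near: y; exact: lt_nbhsr.
Unshelve. all: end_near. Qed.

Let dY1 x : 0 < x -> is_derive x 1 (fun x => 1 + Y x) (p * Y x / x).
Proof.
move=> x0; apply: (is_derive_eq (is_deriveD_fun (is_derive_cstr 1 x) (dY x0))).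
by rewrite add0r.
Qed.

Let dYr s x : 0 < x ->
  is_derive x 1 (fun x => (1 + Y x) `^ s) (s * p * T x / x * (1 + Y x) `^ s).
Proof.
move=> x0; apply: (is_derive_eq (is_derive_powR_fun s (dY1 x0) (Y1_gt0 x))).
rewrite (powR_pred s (Y1_gt0 x)) /T; field.
by rewrite (gt_eqF x0) gt_eqF.
Qed.

Let dT x : 0 < x -> is_derive x 1 T (p * T x * (1 - T x) / x).
Proof.
move=> x0.
have TE : T = fun x => Y x * (1 + Y x) `^ (- 1).
  by apply/funext => z; rewrite powR_inv1// ltW.
rewrite {1}TE; apply: (is_derive_eq (is_deriveM_fun (dY x0) (dYr (- 1) x0))).
rewrite powR_inv1 ?ltW// /T; field.
by rewrite (gt_eqF x0) gt_eqF.
Qed.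

Let onem_sqr_gt0 x : 0 < x < 1 -> 0 < 1 - x ^+ 2.
Proof. by move=> /andP[x0 x1]; rewrite subr_gt0 expr_lt1// ltW. Qed.

Let d1x x : is_derive x 1 (fun x : R => 1 - x ^+ 2) (- (2 * x)).
Proof.
apply: (is_derive_eq (is_deriveB_fun (is_derive_cstr 1 x) (is_derive_sqr x))).
by rewrite sub0r.
Qed.

Let dPhi x : 0 < x < 1 ->
  is_derive x 1 Phi (q / x * (T x + 2 * x ^+ 2 / (1 - x ^+ 2)) * Phi x).
Proof.
move=> x01; have X0 := onem_sqr_gt0 x01; have /andP[x0 _] := x01.
apply: (is_derive_eq (is_deriveM_fun (dYr (q / p) x0) (is_derive_powR_fun (- q) (d1x x) X0))).
rewrite (powR_pred (- q) X0) /Phi (powR_pred (- q) X0).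
set A := (1 + Y x) `^ _; set B := (1 - x ^+ 2) `^ _.
by field; rewrite (gt_eqF x0) (gt_eqF X0) (gt_eqF p0).
Qed.

Let dU x : 0 < x < 1 -> is_derive x 1 U (q / 2 / x * (U x - (1 - x ^+ 2) * V x)).
Proof. by move=> x01; exact: is_derive_pow_mean. Qed.

(** Differentiation brings in the exponent [q / 2 - 2], which the three-term recursion removes. So
    [U] and [V] satisfy a closed linear first-order system, singular at 0 and 1. *)
Let dV x : 0 < x < 1 -> is_derive x 1 V
  (((q / 2 - 1) * V x - ((q - 1) * (1 + x ^+ 2) * V x - q / 2 * U x) / (1 - x ^+ 2)) / x).
Proof.
move=> x01; have X0 := onem_sqr_gt0 x01; have /andP[x0 _] := x01.
apply: (is_derive_eq (is_derive_pow_mean (q / 2 - 1) x01)).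
have := pow_mean_rec (q / 2 - 1) x01; rewrite subrK -/(U x) -/(V x).
move: (U x) (V x) (pow_mean (q / 2 - 1 - 1) x) X0 => u v v' X0 rec.
have -> : q / 2 * u = (2 * (q / 2 - 1) + 1) * (1 + x ^+ 2) * v -
  (q / 2 - 1) * (1 - x ^+ 2) ^+ 2 * v' by lra.
by field; rewrite (gt_eqF x0) (gt_eqF X0).
Qed.

(** The first term is a multiple of [S], with coefficient opposite to the logarithmic derivative of
    [Phi], hence cancelled in [W]; the second one has the sign of [- E x]. *)
Let dS x : 0 < x < 1 -> is_derive x 1 S
  (- (q / x * (T x + 2 * x ^+ 2 / (1 - x ^+ 2)) * S x)
   - U x * (1 - T x) ^+ 2 * Y x * E x / (x * (1 - x ^+ 2))).
Proof.
move=> x01; have X0 := onem_sqr_gt0 x01; have /andP[x0 _] := x01.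
have hT := is_deriveM_fun (is_deriveB_fun (is_derive_cstr (1 / 2) x) (dT x0)) (dU x01).
have hX := is_deriveM_fun (d1x x) (is_derive_cstr 2^-1 x).
have hV := is_deriveM_fun hX (dV x01).
apply: (is_derive_eq (is_deriveB_fun hT hV)).
have Yx : x `^ (2 - p) = x ^+ 2 / Y x.
  rewrite powRB ?(gt_eqF x0) ?implybT// powR_mulrn ?ltW//.
  by rewrite /Y ger0_norm// ltW.
have Yx' : x `^ p = Y x by rewrite /Y ger0_norm// ltW.
have Yp : 0 < Y x by rewrite -Yx' powR_gt0.
rewrite /S /E /sign_fun Yx Yx' /T.
have Y1 := Y1_gt0 x.
move: (U x) (V x) (Y x) Yp Y1 X0 => u v y y0 y1 X0.
by field; rewrite (gt_eqF x0) (gt_eqF X0) (gt_eqF y0) (gt_eqF y1).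
Qed.

Let dW x : 0 < x < 1 -> is_derive x 1 W
  (- (Phi x * U x * (1 - T x) ^+ 2 * Y x / (x * (1 - x ^+ 2)) * E x)).
Proof.
move=> x01; have X0 := onem_sqr_gt0 x01; have /andP[x0 _] := x01.
apply: (is_derive_eq (is_deriveM_fun (dPhi x01) (dS x01))).
move: (Phi x) (S x) (U x) (E x) (T x) (Y x) X0 => f s u ex t y X0.
by field; rewrite (gt_eqF x0) (gt_eqF X0).
Qed.

Let dr x : 0 < x < 1 -> is_derive x 1 r (q / x * N x * S x).
Proof.
move=> x01; have /andP[x0 _] := x01.
apply: (is_derive_eq (is_deriveM_fun (dU x01) (dYr (- (q / p)) x0))).
rewrite -/(N x) /S; move: (N x) (U x) (V x) (T x) => n u v t.
by field; rewrite (gt_eqF x0) (gt_eqF p0).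
Qed.

Let cY : continuous Y. Proof. exact: continuous_norm_powR. Qed.

Let cYr s : continuous (fun x => (1 + Y x) `^ s).
Proof.
apply: cts_powR_gt0; last exact: Y1_gt0.
by apply: ctsD; [exact: cts_cst|exact: cY].
Qed.

Let cT : continuous T.
Proof.
have -> : T = fun x => Y x * (1 + Y x) `^ (- 1).
  by apply/funext => z; rewrite powR_inv1// ltW.
by apply: ctsM; [exact: cY|exact: cYr].
Qed.

Let cU x : 0 <= x <= 1 -> {for x, continuous U}.
Proof. by move=> x01; apply: continuous_pow_mean => //; rewrite divr_ge0// ltW. Qed.

Let cV x : 0 <= x <= 1 -> {for x, continuous V}.
Proof. by move=> x01; apply: continuous_pow_mean => //; move: q2; lra. Qed.

Let c1x : continuous (fun x : R => 1 - x ^+ 2).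
Proof. by move=> x; exact: is_derive_continuous (d1x x). Qed.

(** The factor [Phi] is unbounded near 1, so [W] is followed on [0, 1[ only, starting from the value
    0 at 0. *)
Let cW x : 0 <= x < 1 -> {for x, continuous W}.
Proof.
move=> /andP[x0 x1].
have x01 : 0 <= x <= 1 by rewrite x0 ltW.
have cP : {for x, continuous Phi}.
  apply: cvgM; first exact: cYr.
  apply: (is_derive_continuous (is_derive_powR_fun (- q) (d1x x) _)).
  by rewrite subr_gt0 expr_lt1.
apply: cvgM; first exact: cP.
apply: cvgB.
  apply: cvgM; last exact: cU.
  by apply: cvgB; [exact: cvg_cst|exact: cT].
apply: cvgM; last exact: cV.
by apply: cvgM; [exact: c1x|exact: cvg_cst].
Qed.

Let cr x : 0 <= x <= 1 -> {for x, continuous r}.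
Proof. by move=> x01; apply: cvgM; [exact: cU|exact: cYr]. Qed.

Let cW_itv a c : 0 <= a -> c < 1 -> {within `[a, c], continuous W}.
Proof.
move=> a0 c1; apply: continuous_in_subspaceT => u; rewrite inE/= in_itv/= => /andP[au uc].
by apply: cW; rewrite (le_trans a0)// (le_lt_trans uc).
Qed.

Let cr_itv a c : 0 <= a -> c <= 1 -> {within `[a, c], continuous r}.
Proof.
move=> a0 c1; apply: continuous_in_subspaceT => u; rewrite inE/= in_itv/= => /andP[au uc].
by apply: cr; rewrite (le_trans a0)// (le_trans uc).
Qed.

Let Y0 : Y 0 = 0. Proof. by rewrite /Y normr0 powR0// gt_eqF. Qed.

Let W0 : W 0 = 0.
Proof.
rewrite /W /S /T Y0 mul0r subr0 expr0n/= subr0 /U /V !pow_mean0 !mulr1 subrr.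
by rewrite mulr0.
Qed.

Let r0 : r 0 = 1.
Proof. by rewrite /r /U /N Y0 pow_mean0 addr0 powR1 mulr1. Qed.

Let Phi_gt0 x : 0 < x < 1 -> 0 < Phi x.
Proof.
move=> x01; apply: mulr_gt0; apply: powR_gt0; first exact: Y1_gt0.
exact: onem_sqr_gt0.
Qed.

Let W'_sign x : 0 < x < 1 ->
  0 <= Phi x * U x * (1 - T x) ^+ 2 * Y x / (x * (1 - x ^+ 2)).
Proof.
move=> x01; have /andP[x0 x1] := x01.
have f0 := ltW (Phi_gt0 x01); have X0 := ltW (onem_sqr_gt0 x01).
apply: divr_ge0; last exact: (mulr_ge0 (ltW x0) X0).
exact: (mulr_ge0 (mulr_ge0 (mulr_ge0 f0 (pow_mean_ge0 _ _)) (sqr_ge0 _)) (Y_ge0 x)).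
Qed.

Let S_sign x : 0 < x < 1 -> (0 <= W x -> 0 <= S x) /\ (W x <= 0 -> S x <= 0).
Proof.
by move=> x01; rewrite /W pmulr_rge0 ?pmulr_rle0//; exact: Phi_gt0.
Qed.

(** Once negative, [E] stays negative up to 1. So [0 <= E x] forces [E] to be nonnegative on all of
    ]0, x], where [W] then decreases from [W 0 = 0]. *)
Let W_le0 x : 0 < x < 1 -> 0 <= E x -> W x <= 0.
Proof.
move=> /andP[x0 x1] Ex; rewrite -W0.
have dWx z : 0 < z < x -> is_derive z 1 W
    (- (Phi z * U z * (1 - T z) ^+ 2 * Y z / (z * (1 - z ^+ 2)) * E z)).
  by move=> /andP[z0 zx]; apply: dW; rewrite z0 (lt_trans zx).
apply: (is_derive_nincr (cW_itv (lexx 0) x1) dWx _ (lexx 0) (ltW x0) (lexx x)).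
move=> z /andP[z0 zx]; rewrite oppr_le0 mulr_ge0//.
  by apply: W'_sign; rewrite z0 (lt_trans zx).
rewrite leNgt; apply/negP => Ez.
by have := sign_fun_lt0 p1 p2 q2 z0 zx x1 Ez; rewrite ltNge -/E Ex.
Qed.

Let W_ndecr z x : 0 < z -> z <= x -> x < 1 -> E z < 0 -> W z <= W x.
Proof.
move=> z0 zx x1 Ez.
have dWx u : z < u < x -> is_derive u 1 W
    (- (Phi u * U u * (1 - T u) ^+ 2 * Y u / (u * (1 - u ^+ 2)) * E u)).
  by move=> /andP[zu ux]; apply: dW; rewrite (lt_trans z0)// (lt_trans ux).
apply: (is_derive_ndecr (cW_itv (ltW z0) x1) dWx _ (lexx z) zx (lexx x)).
move=> u /andP[zu ux]; rewrite oppr_ge0 mulr_ge0_le0//.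
  by apply: W'_sign; rewrite (lt_trans z0)// (lt_trans ux).
by apply: ltW; apply: (sign_fun_lt0 p1 p2 q2 z0 zu (lt_trans ux x1) Ez).
Qed.

(** The quotient [r] is compared with its value at one of the end points, chosen by the signs at [x]
    itself. If [E x < 0 <= W x], then [W] stays nonnegative to the right of [x] and [r x <= r 1];
    otherwise [W] is nonpositive on all of ]0, x[ and [r x <= r 0 = 1]. *)
Lemma pow_mean_le_unit x : pow_mean (q / 2) 1 <= 2 `^ (q / p) -> 0 <= x <= 1 ->
  pow_mean (q / 2) x <= (1 + x `^ p) `^ (q / p).
Proof.
move=> H1 /andP[x0 x1].
have rE z : 0 <= z -> (pow_mean (q / 2) z <= (1 + z `^ p) `^ (q / p)) = (r z <= 1).
  move=> z0; rewrite /r /N powRN ler_pdivrMr ?powR_gt0// mul1r /Y ger0_norm//.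
rewrite rE//.
have r1 : r 1 <= 1 by rewrite -rE// powR1.
have [->|x0'] := eqVneq x 0; first by rewrite r0.
have [->//|x1'] := eqVneq x 1.
have {x0'}xp : 0 < x by rewrite lt_neqAle eq_sym x0'.
have {x1'}xl : x < 1 by rewrite lt_neqAle x1'.
have decr : (forall z, 0 < z < x -> W z <= 0) -> r x <= 1.
  move=> Wz; rewrite -r0.
  have drz z : 0 < z < x -> is_derive z 1 r (q / z * N z * S z).
    by move=> /andP[z0 zx]; apply: dr; rewrite z0 (lt_trans zx).
  apply: (is_derive_nincr (cr_itv (lexx 0) x1) drz _ (lexx 0) x0 (lexx x)).
  move=> z z0x; have /andP[z0 zx] := z0x.
  rewrite mulr_ge0_le0// ?mulr_ge0 ?powR_ge0 ?invr_ge0 ?(ltW z0) ?(ltW q0)//.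
  by apply: (S_sign _).2; [rewrite z0 (lt_trans zx)|exact: Wz].
have [Ex|Ex] := leP 0 (E x).
  apply: decr => z /andP[z0 zx]; apply: W_le0; first by rewrite z0 (lt_trans zx).
  rewrite leNgt; apply/negP => Ez.
  by have := sign_fun_lt0 p1 p2 q2 z0 zx xl Ez; rewrite ltNge -/E Ex.
have [Wx|Wx] := leP 0 (W x).
  apply: le_trans r1.
  have drz z : x < z < 1 -> is_derive z 1 r (q / z * N z * S z).
    by move=> /andP[xz z1]; apply: dr; rewrite z1 (lt_trans xp).
  apply: (is_derive_ndecr (cr_itv x0 (lexx 1)) drz _ (lexx x) x1 (lexx 1)).
  move=> z /andP[xz z1]; have z0 := lt_trans xp xz.
  rewrite mulr_ge0// ?mulr_ge0 ?powR_ge0 ?invr_ge0 ?(ltW z0) ?(ltW q0)//.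
  apply: (S_sign _).1; first by rewrite z0.
  by apply: le_trans Wx _; apply: W_ndecr => //; exact: ltW.
apply: decr => z /andP[z0 zx].
have [Ez|Ez] := leP 0 (E z); first by apply: W_le0; rewrite // z0 (lt_trans zx).
by apply: (le_trans (W_ndecr z0 (ltW zx) xl Ez)); exact: ltW.
Qed.

End two_point_unit.

Section two_point.
Context {R : realType} (p q : R).
Context (p1 : 1 < p) (p2 : p < 2) (q2 : 2 < q).
Context (pq : pow_mean (q / 2) 1 <= 2 `^ (q / p) :> R).

(** Both sides are symmetric and homogeneous of degree [q], so dividing by the larger variable
    reduces to [pow_mean_le_unit]. *)
Lemma two_point (x y : R) : 0 <= x -> 0 <= y ->
  mean (fun t => (x ^+ 2 + y ^+ 2 + 2 * x * y * ccos t) `^ (q / 2)) <=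
  (x `^ p + y `^ p) `^ (q / p).
Proof.
have q0 : 0 < q by move: q2; lra.
have p0 : 0 < p by move: p1; lra.
wlog yx : x y / y <= x.
  move=> H x0 y0; have [yx|/ltW xy] := leP y x; first exact: H.
  rewrite [leRHS](_ : _ = (y `^ p + x `^ p) `^ (q / p)); last by rewrite addrC.
  rewrite [leLHS](_ : _ = mean (fun t => (y ^+ 2 + x ^+ 2 + 2 * y * x * ccos t) `^ (q / 2))).
    exact: H.
  by congr mean; apply/funext => t; congr powR; ring.
move=> x0 y0; have [xe|xn] := eqVneq x 0.
  have -> : y = 0 by apply/le_anti; rewrite y0 andbT -xe.
  rewrite xe (_ : (fun t => _) = (fun=> 0)) ?mean_cst ?powR_ge0//.
  apply/funext => t; rewrite expr0n/= mulr0 mul0r !addr0 powR0// gt_eqF//.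
  by rewrite divr_gt0.
have xp : 0 < x by rewrite lt_neqAle eq_sym xn.
pose z := y / x.
have z01 : 0 <= z <= 1 by rewrite divr_ge0//= ler_pdivrMr// mul1r.
have yE : y = z * x by rewrite divfK.
have := pow_mean_le_unit p1 p2 q2 pq z01.
have z0 : 0 <= z by case/andP: z01.
have -> : x `^ p + y `^ p = (1 + z `^ p) * x `^ p.
  by rewrite yE powRM//; ring.
rewrite (powRM _ _ (powR_ge0 _ _)) ?addr_ge0 ?powR_ge0//.
have -> : (x `^ p) `^ (q / p) = x `^ q by rewrite -powRrM mulrCA mulfV ?gt_eqF// mulr1.
have -> : mean (fun t => (x ^+ 2 + y ^+ 2 + 2 * x * y * ccos t) `^ (q / 2)) =
    x `^ q * pow_mean (q / 2) z.
  rewrite /pow_mean -meanZ; last by apply: continuous_sqr_dist_powR; rewrite divr_ge0// ltW.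
  congr mean; apply/funext => t.
  have -> : x ^+ 2 + y ^+ 2 + 2 * x * y * ccos t = x ^+ 2 * sqr_dist z t.
    by rewrite yE /sqr_dist; ring.
  rewrite powRM ?sqr_ge0 ?sqr_dist_ge0//; congr (_ * _).
  by rewrite -powR_mulrn// -powRrM; congr powR; field.
move=> H; rewrite mulrC; exact: ler_wpM2r (powR_ge0 _ _) _ _ H.
Qed.

End two_point.

(** * Convex comparison *)

Section jensen.
Context {R : realType}.
Implicit Types r t : R.

Let f r t := ln (sqr_dist r t).

Let cf r : 0 <= r -> r < 1 -> continuous (f r).
Proof.
move=> r0 r1; apply: cts_ln; first exact: continuous_sqr_dist.
by move=> t; exact: sqr_dist_gt0.
Qed.

Lemma sqr_distD1 r t : sqr_dist r (t + 1) = sqr_dist r t.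
Proof. by rewrite /sqr_dist ccosD1. Qed.

(* |1 + r z| |1 - r z| = |1 - r^2 z^2| on the unit circle *)
Lemma sqr_dist_duplication r t :
  sqr_dist r t * sqr_dist r (t + 2^-1) = sqr_dist (r ^+ 2) (2 * t + 2^-1).
Proof. by rewrite /sqr_dist !ccosDhalf ccos_double; ring. Qed.

Let mean_sqr r : 0 <= r -> r < 1 -> 2 * mean (f r) = mean (f (r ^+ 2)).
Proof.
move=> r0 r1.
have r20 : 0 <= r ^+ 2 by rewrite exprn_ge0.
have r21 : r ^+ 2 < 1 by rewrite expr_lt1.
have cr := cf r0 r1; have cr2 := cf r20 r21.
have p1 t : f r (t + 1) = f r t by rewrite /f sqr_distD1.
have p2 t : f (r ^+ 2) (t + 1) = f (r ^+ 2) t by rewrite /f sqr_distD1.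
rewrite -(mean_double cr2 p2 2^-1).
have -> : (fun t => f (r ^+ 2) (2 * t + 2^-1)) = (fun t => f r t + f r (t + 2^-1)).
  apply/funext => t; rewrite /f -sqr_dist_duplication lnM//.
    by rewrite posrE sqr_dist_gt0.
  by rewrite posrE sqr_dist_gt0.
have cs : continuous (fun t => f r (t + 2^-1)).
  have ca : continuous (fun t : R => t + 2^-1) by apply: ctsD; [exact: cts_id|exact: cts_cst].
  exact: (cts_comp ca cr).
by rewrite meanD// (mean_shift cr p1); ring.
Qed.

(** Duplication doubles the mean whenever [r] is squared, while all these means are at most [ln 10].
    A positive mean would grow past this bound after finitely many squarings. *)
Lemma mean_ln_sqr_dist_le0 r : 0 <= r -> r < 1 -> mean (fun t => ln (sqr_dist r t)) <= 0.
Proof.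
move=> r0 r1; rewrite -/(f r) leNgt; apply/negP => I0.
have I_le s : 0 <= s -> s < 1 -> mean (f s) <= ln 10.
  move=> s0 s1; rewrite -(mean_cst (ln 10)); apply: le_mean; first exact: cf.
    exact: cts_cst.
  move=> t; rewrite /f ler_ln ?posrE ?sqr_dist_gt0//.
  by apply: sqr_dist_le; lra.
have pow n : exists2 s, 0 <= s < 1 & 2 ^+ n * mean (f r) = mean (f s).
  elim: n => [|n [s /andP[s0 s1] IH]]; first by exists r; rewrite ?r0// expr0 mul1r.
  exists (s ^+ 2); first by rewrite exprn_ge0//= expr_lt1.
  by rewrite exprS -mulrA IH mean_sqr.
set I := mean (f r) in I0 pow.
have l0 : 0 <= ln (10 : R) / I by rewrite divr_ge0 ?ln_ge0 ?ler1n// ltW.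
have [s /andP[s0 s1] Is] := pow (Num.bound (ln (10 : R) / I)).
have := I_le _ s0 s1; rewrite -Is leNgt => /negP; apply.
rewrite -ltr_pdivrMr//; apply: lt_trans (archi_boundP l0) _.
by rewrite -natrX ltr_nat ltn_expl.
Qed.

End jensen.

(** * Convexity inequalities for the exponential *)

Section exp_inequalities.
Context {R : realType}.
Implicit Types a b x k : R.

(** The tangent at [x] lies below the curve at [a] and at [b]; adding these two facts with weights
    [b - x] and [x - a] cancels the slope. *)
Lemma expR_chord k a x b : a <= x -> x <= b ->
  (b - a) * expR (k * x) <= (b - x) * expR (k * a) + (x - a) * expR (k * b).
Proof.
move=> ax xb.
have tangent y : expR (k * x) * (1 + k * (y - x)) <= expR (k * y).
  have -> : k * y = k * x + k * (y - x) by ring.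
  by rewrite expRD ler_wpM2l ?expR_ge0// expR_ge1Dx.
have bx : 0 <= b - x by rewrite subr_ge0.
have xa : 0 <= x - a by rewrite subr_ge0.
have := lerD (ler_wpM2l bx (tangent a)) (ler_wpM2l xa (tangent b)).
by apply: le_trans; apply: eq_ler; ring.
Qed.

Lemma expR_slope b a : 0 <= b -> b <= a -> a * (expR b - 1) <= b * (expR a - 1).
Proof.
move=> b0 ba; have := expR_chord 1 b0 ba.
by rewrite !mul1r expR0 !subr0; lra.
Qed.

Let g c x := (1 - expR (- (c * x))) * (1 - expR (- (c / x))).

Let dg c x : 0 < x -> is_derive x 1 (g c)
  (expR (- (c * x) - c / x) / x * ((c * x) * (expR (c / x) - 1) - c / x * (expR (c * x) - 1))).
Proof.
move=> x0; have xn : x != 0 by rewrite gt_eqF.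
have h1 := is_deriveB_fun (is_derive_cstr 1 x) (@is_derive1_comp R expR (fun y => - (c * y)) x _ _
  (is_derive_expR (- (c * x))) (is_deriveN_fun (is_deriveZ_fun c (is_derive_idr x)))).
have hV : is_derive x 1 (fun y : R => y^-1) (- x ^- 2).
  by apply: (is_derive_eq (@is_deriveV R (fun y => y) x 1 1 xn (is_derive_idr x))); rewrite /GRing.scale/= mulr1.
have h2 := is_deriveB_fun (is_derive_cstr 1 x) (@is_derive1_comp R expR (fun y => - (c * y^-1)) x _ _
  (is_derive_expR (- (c / x))) (is_deriveN_fun (is_deriveZ_fun c hV))).
apply: (is_derive_eq (is_deriveM_fun h1 h2)).
rewrite /GRing.scale/= expRD.
have := expR_gt0 (c * x); have := expR_gt0 (c / x).
rewrite !expRN; move: (expR (c / x)) (expR (c * x)) => u v u0 v0.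
by field; rewrite xn (gt_eqF u0) (gt_eqF v0).
Qed.

(** For a fixed product c^2 of [u] and [v], write u = c x and v = c / x. The left-hand side is then
    [g c x], which decreases for x >= 1 because (e^s - 1) / s increases in s, and at x = 1 it is the
    right-hand side. *)
Lemma onem_expR_geometric (u v : R) : 0 <= u -> 0 <= v ->
  (1 - expR (- u)) * (1 - expR (- v)) <= (1 - expR (- Num.sqrt (u * v))) ^+ 2.
Proof.
wlog vu : u v / v <= u.
  move=> H u0 v0; have [vu|/ltW uv] := leP v u; first exact: H.
  by rewrite mulrC (mulrC u); exact: H.
move=> u0; rewrite le_eqVlt => /predU1P[<-|v0].
  by rewrite oppr0 expR0 subrr mulr0 mulr0 sqrtr0 oppr0 expR0 subrr expr0n.
have {u0}up : 0 < u by exact: lt_le_trans vu.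
set c := Num.sqrt (u * v).
have c0 : 0 < c by rewrite sqrtr_gt0 mulr_gt0.
have cc : c * c = u * v by rewrite -expr2 sqr_sqrtr// mulr_ge0// ltW.
pose x := u / c.
have uE : u = c * x by rewrite mulrC divfK// gt_eqF.
have vE : v = c / x.
  by rewrite /x invf_div mulrA cc mulrC mulKf// gt_eqF.
have x1 : 1 <= x.
  rewrite ler_pdivlMr// mul1r -[leRHS]ger0_norm ?(ltW up)// -sqrtr_sqr ler_wsqrtr//.
  by rewrite expr2 ler_wpM2l// ltW.
have cg : {within `[1, x], continuous (g c)}.
  apply: continuous_in_subspaceT => z; rewrite inE/= in_itv/= => /andP[z1 _].
  by apply: (is_derive_continuous (dg c _)); exact: lt_le_trans z1.
have dgx z : 1 < z < x -> is_derive z 1 (g c) (expR (- (c * z) - c / z) / z *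
    ((c * z) * (expR (c / z) - 1) - c / z * (expR (c * z) - 1))).
  by move=> /andP[z1 _]; apply: dg; exact: lt_trans z1.
have := is_derive_nincr cg dgx _ (lexx 1) x1 (lexx x).
rewrite /g mulr1 divr1 -uE -vE -expr2; apply => z /andP[z1 zx].
have z0 : 0 < z := lt_trans ltr01 z1.
rewrite mulr_ge0_le0 ?divr_ge0 ?expR_ge0 ?(ltW z0)// subr_le0.
apply: expR_slope; first by rewrite divr_ge0// ltW.
rewrite ler_pdivrMr// -mulrA ler_peMr ?(ltW c0)//.
by rewrite -expr2; apply: exprn_ege1; exact: ltW.
Qed.

End exp_inequalities.

Section convex_comparison.
Context {R : realType}.

(** The tangent to the [a]-th power at [u] gives v^a >= u^a + d (v - u). The single crossing lets
    one constant [k >= 0] replace the slope [d], and the mean of [k * (v - u)] is nonnegative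
    because [mean u <= s = mean v]. *)
Lemma mean_log_le (u0 u1 a : R) : 0 <= u0 -> 0 <= u1 -> 1 <= a ->
  mean (fun t => (u0 + u1 +
      ln (sqr_dist (Num.sqrt ((1 - expR (- u0)) * (1 - expR (- u1)))) t)) `^ a) <=
  mean (fun t => (u0 + u1 + 2 * Num.sqrt (u0 * u1) * ccos t) `^ a).
Proof.
move=> u00 u10 a1.
have a0 : 0 < a by lra.
set s := u0 + u1; set r := Num.sqrt (_ * (1 - _)); set c := Num.sqrt (u0 * u1).
have e_ge0 (u : R) : 0 <= u -> 0 <= 1 - expR (- u) < 1.
  by move=> u_ge0; rewrite subr_ge0 -{1}(expR0 R) ler_expR oppr_le0 u_ge0/= ltrBlDr ltrDl expR_gt0.
have /andP[e00 e01] := e_ge0 _ u00; have /andP[e10 e11] := e_ge0 _ u10.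
have r0 : 0 <= r by exact: sqrtr_ge0.
have c0 : 0 <= c by exact: sqrtr_ge0.
have r1 : r < 1 by rewrite -[ltRHS]sqrtr1 ltr_sqrt// mulr_ilt1.
(* At cosine -1 this says that v = s - 2 c is at most u = s + 2 ln (1 - r). *)
have rc : expR (- c) <= 1 - r.
  have /andP[ec0 _] := e_ge0 _ c0.
  have : r <= 1 - expR (- c).
    rewrite -[leRHS]ger0_norm// -sqrtr_sqr ler_wsqrtr//; exact: onem_expR_geometric.
  by rewrite lerBrDr addrC -lerBrDr.
(* The arithmetic-geometric mean inequality, which makes both [u] and [v] nonnegative. *)
have cs : 2 * c <= s.
  have : 0 <= (Num.sqrt u0 - Num.sqrt u1) ^+ 2 by exact: sqr_ge0.
  by rewrite sqrrB !sqr_sqrtr// -sqrtrM// -/c /s; lra.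
pose u t := s + ln (sqr_dist r t); pose v t := s + 2 * c * ccos t.
have X0 t : 0 < sqr_dist r t by exact: sqr_dist_gt0.
have u_ge t : s - 2 * c <= u t.
  rewrite /u lerD2l -[leLHS]expRK ler_ln ?posrE ?expR_gt0//.
  apply: le_trans (sqr_dist_ge t r0).
  have -> : expR (- (2 * c)) = expR (- c) ^+ 2 by rewrite -expRM_natl; congr expR; lra.
  by rewrite lerXn2r ?nnegrE ?expR_ge0// ltW// subr_gt0.
have u_ge0 t : 0 <= u t by apply: le_trans (u_ge t); rewrite subr_ge0.
have v_ge0 t : 0 <= v t.
  have /andP[h1 h2] := ccos_le1 t; rewrite /v.
  have : 0 <= 2 * c * (1 + ccos t) by rewrite !mulr_ge0//; lra.
  lra.
(* After exponentiation, [w] carries the sign of [u - v] as a function of the cosine z. *)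
pose w (z : R) := 1 + r ^+ 2 + 2 * r * z - expR (2 * c * z).
have w_uv t : (0 <= w (ccos t)) = (v t <= u t).
  by rewrite /u /v lerD2l -[RHS]ler_expR lnK ?posrE// /w subr_ge0.
have w_N1 : 0 <= w (- 1).
  rewrite /w subr_ge0 (_ : expR _ = expR (- c) ^+ 2); last first.
    by rewrite -expRM_natl; congr expR; ring.
  rewrite (_ : _ + _ = (1 - r) ^+ 2); last by ring.
  by rewrite lerXn2r ?nnegrE ?expR_ge0// ltW// subr_gt0.
(* [w] is concave, hence nonnegative between two points where it is. *)
have w_down z y : 0 <= w z -> - 1 <= y -> y <= z -> 0 <= w y.
  move=> wz y1 yz; have [zy|zn] := eqVneq z (- 1).
    by rewrite (_ : y = - 1)//; apply/le_anti; rewrite y1 -zy yz.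
  have z1 : 0 < z - -1 by rewrite subr_gt0 lt_neqAle eq_sym zn (le_trans y1).
  rewrite -(pmulr_rge0 _ z1) /w mulrBr subr_ge0.
  apply: le_trans (expR_chord (2 * c) y1 yz) _.
  have zy : 0 <= z - y by rewrite subr_ge0.
  have y1' : 0 <= y - -1 by rewrite subr_ge0.
  have := lerD (mulr_ge0 zy w_N1) (mulr_ge0 y1' wz).
  by rewrite /w addr0 -subr_ge0 subr0 -subr_ge0 => H; rewrite -subr_ge0; apply: le_trans H _; apply: eq_ler; ring.
pose d t := a * u t `^ (a - 1).
have d_ge0 t : 0 <= d t by rewrite mulr_ge0 ?powR_ge0 ?ltW.
have u_mono t t' : ccos t <= ccos t' -> u t <= u t'.
  move=> tt; rewrite /u lerD2l ler_ln ?posrE// /sqr_dist lerD2l ler_wpM2l//.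
  by rewrite mulr_ge0.
have d_mono t t' : ccos t <= ccos t' -> d t <= d t'.
  move=> tt; rewrite /d ler_wpM2l ?(ltW a0)// ge0_ler_powR ?nnegrE ?u_ge0 ?u_mono//; lra.
(* These are the tangent slopes at the points where [v <= u]. Their supremum serves as threshold
   without locating a crossing; the set contains the slope at t = 1/2, where the cosine is -1, and
   is bounded by the slope at t = 0. *)
pose A := [set d t | t in [set t | 0 <= w (ccos t)]].
have cos_half : ccos 2^-1 = - 1 :> R.
  by rewrite -[2^-1]add0r ccosDhalf /ccos mulr0 cos0.
have cos_0 : ccos 0 = 1 :> R by rewrite /ccos mulr0 cos0.
have A_sup : has_sup A.
  split; first by exists (d 2^-1), 2^-1; rewrite //= cos_half.
  exists (d 0) => _ [t _ <-]; apply: d_mono; rewrite cos_0.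
  by have /andP[] := ccos_le1 t.
(* The slope [d] of the tangent to [x `^ a] at [u] is at most [k] where
   [v <= u] and at least [k] where [u <= v]. *)
pose k := sup A.
have k0 : 0 <= k.
  apply: le_trans (d_ge0 2^-1) _; apply: sup_upper_bound => //.
  by exists 2^-1; rewrite //= cos_half.
have key t : k * (v t - u t) <= d t * (v t - u t).
  have [wt|wt] := leP 0 (w (ccos t)).
    have vu : v t - u t <= 0 by rewrite subr_le0 -w_uv.
    rewrite ler_wnM2r//; apply: sup_upper_bound => //; by exists t.
  have uv : 0 <= v t - u t.
    by rewrite subr_ge0 ltW// ltNge -w_uv -ltNge.
  rewrite ler_wpM2r//; apply: ge_sup; first by case: A_sup.
  move=> _ [t' /= wt' <-]; apply: d_mono; rewrite leNgt; apply/negP => tt.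
  have /andP[h1 _] := ccos_le1 t.
  by have := w_down _ _ wt' h1 (ltW tt); rewrite leNgt wt.
have cu : continuous u.
  apply: ctsD; first exact: cts_cst.
  by apply: cts_ln => //; exact: continuous_sqr_dist.
have cv : continuous v.
  by apply: ctsD; [exact: cts_cst|apply: ctsM; [exact: cts_cst|exact: continuous_ccos]].
have mv : mean v = s.
  rewrite /v meanD ?mean_cst ?meanZ ?mean_ccos ?mulr0 ?addr0//.
  - exact: continuous_ccos.
  - exact: cts_cst.
  - by apply: ctsM; [exact: cts_cst|exact: continuous_ccos].
have mu : mean u <= s.
  rewrite /u meanD ?mean_cst.
  - by rewrite gerDl; exact: mean_ln_sqr_dist_le0.
  - exact: cts_cst.
  - by apply: cts_ln => //; exact: continuous_sqr_dist.
have cua : continuous (fun t => u t `^ a) by apply: cts_powR => //; exact: ltW.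
have cva : continuous (fun t => v t `^ a) by apply: cts_powR => //; exact: ltW.
have ck : continuous (fun t => k * (v t - u t)).
  by apply: ctsM; [exact: cts_cst|exact: ctsB].
have : mean (fun t => u t `^ a + k * (v t - u t)) <= mean (fun t => v t `^ a).
  apply: le_mean => //; first exact: ctsD.
  move=> t; apply: le_trans (powR_tangent a1 (u_ge0 t) (v_ge0 t)).
  by rewrite lerD2l; exact: key.
rewrite meanD// meanZ; last exact: ctsB.
rewrite meanB// mv; apply: le_trans; rewrite lerDl mulr_ge0// subr_ge0//.
Qed.

End convex_comparison.

(** * Products in SU(1,1) and integration over the torus *)

Section su11_algebra.
Context {R : realType}.
Local Open Scope complex_scope.
Implicit Types (A B z : R[i]) (s x y : R).

Lemma normc_sqr z : Normc.normc z ^+ 2 = complex.Re z ^+ 2 + complex.Im z ^+ 2.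
Proof. by case: z => x y /=; rewrite sqr_sqrtr// addr_ge0// sqr_ge0. Qed.

Lemma su11_mx_mul A B A' B' : su11_mx A B *m su11_mx A' B' =
  su11_mx (A * A' + B * B'^*) (A * B' + B * A'^*).
Proof.
apply/matrixP => i j; rewrite !mxE big_ord_recr big_ord1 /= !mxE /=.
case: i => -[|[|//]] /= ?; case: j => -[|[|//]] /= ? //;
  case: A B A' B' => [a1 a2] [b1 b2] [c1 c2] [d1 d2];
  by apply/eqP; rewrite eq_complex /=; apply/andP; split; apply/eqP; ring.
Qed.

Lemma su11_norm_mul A B A' B' :
  Normc.normc (A * A' + B * B'^*) ^+ 2 - Normc.normc (A * B' + B * A'^*) ^+ 2 =
  (Normc.normc A ^+ 2 - Normc.normc B ^+ 2) * (Normc.normc A' ^+ 2 - Normc.normc B' ^+ 2).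
Proof.
rewrite !normc_sqr; case: A B A' B' => [a1 a2] [b1 b2] [c1 c2] [d1 d2] /=; ring.
Qed.

Lemma SU11_mulmx (G H : 'M[R[i]]_2) : SU11 G -> SU11 H -> SU11 (G *m H).
Proof.
move=> [A [B [AB ->]]] [A' [B' [AB' ->]]]; exists (A * A' + B * B'^*), (A * B' + B * A'^*).
by rewrite su11_norm_mul AB AB' mulr1 su11_mx_mul.
Qed.

Lemma expi_double x : expi x * expi x = expi (2 * x) :> R[i].
Proof.
rewrite /expi mulr_natl cos_mulr2n sin_mulr2n; apply/eqP; rewrite eq_complex /=.
have := cos2Dsin2 x => cs; apply/andP; split; apply/eqP; last by ring.
by rewrite -!expr2 mulr2n; lra.
Qed.

Lemma expiN x : expi (- x) = (expi x)^* :> R[i].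
Proof. by rewrite /expi cosN sinN. Qed.

Lemma expi_norm x : expi x * (expi x)^* = 1 :> R[i].
Proof.
apply/eqP; rewrite eq_complex /= -!expr2.
by have := cos2Dsin2 x => cs; apply/andP; split; apply/eqP; [lra|ring].
Qed.

Lemma invmx_D s : invmx (D s) = D (- s) :> 'M[R[i]]_2.
Proof.
have DD : D s *m D (- s) = 1%:M :> 'M[R[i]]_2.
  apply/matrixP => i j; rewrite !mxE big_ord_recr big_ord1 /= !mxE /= mulrN opprK expiN.
  case: i => -[|[|//]] /= ?; case: j => -[|[|//]] /= ?;
    by rewrite /= ?mulr0 ?mul0r ?addr0 ?add0r ?expi_norm// mulrC expi_norm.
by rewrite -[RHS]mul1mx -(mulVmx (D_unitmx s)) -mulmxA DD mulmx1.
Qed.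

Lemma conjD_su11 s A B :
  conjD s (su11_mx A B) = su11_mx A (B * expi (2 * (pi * s))).
Proof.
rewrite /conjD invmx_D.
have DE u : D u = su11_mx (expi (pi * u)) 0 :> 'M[R[i]]_2.
  by apply/matrixP => i j; rewrite !mxE expiN rmorph0.
rewrite !DE !su11_mx_mul mulrN expiN -expi_double rmorph0 !mulr0 !mul0r !addr0 !add0r.
have e1 := expi_norm (pi * s).
congr su11_mx; first by rewrite mulrAC e1 mul1r.
transitivity (expi (pi * s) * B * expi (pi * s)); last by rewrite mulrAC mulrC.
by congr (_ * _); exact: conjcK.
Qed.

Lemma polar x y : exists th : R,
  x = Num.sqrt (x ^+ 2 + y ^+ 2) * ccos th /\ y = Num.sqrt (x ^+ 2 + y ^+ 2) * csin th.
Proof.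
set r := Num.sqrt _.
have r2 : r ^+ 2 = x ^+ 2 + y ^+ 2 by rewrite sqr_sqrtr// addr_ge0// sqr_ge0.
have pi0 : 2 * pi != 0 :> R by rewrite mulf_neq0 ?pnatr_eq0// gt_eqF// pi_gt0.
suff [ph [hx hy]] : exists ph, x = r * cos ph /\ y = r * sin ph.
  have e : 2 * pi * (ph / (2 * pi)) = ph by rewrite mulrC divfK.
  by exists (ph / (2 * pi)); rewrite /ccos /csin e.
have [r0|rn] := eqVneq r 0.
  have xy : x ^+ 2 + y ^+ 2 = 0 by rewrite -r2 r0 expr0n.
  have x0 : x = 0 by apply/eqP; rewrite -sqrf_eq0; apply/eqP; have := sqr_ge0 x; have := sqr_ge0 y; lra.
  have y0 : y = 0 by apply/eqP; rewrite -sqrf_eq0; apply/eqP; have := sqr_ge0 x; have := sqr_ge0 y; lra.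
  by exists 0; rewrite x0 y0 r0 !mul0r.
have rp : 0 < r by rewrite lt_neqAle eq_sym rn sqrtr_ge0.
have xr : -1 <= x / r <= 1.
  rewrite -ler_norml normrM normfV (gtr0_norm rp) ler_pdivrMr// mul1r.
  by rewrite -sqrtr_sqr ler_wsqrtr// lerDl sqr_ge0.
have sr : Num.sqrt (1 - (x / r) ^+ 2) = `|y| / r.
  have -> : 1 - (x / r) ^+ 2 = (y / r) ^+ 2.
    have y2 : y ^+ 2 = r ^+ 2 - x ^+ 2 by lra.
    by rewrite !expr_div_n y2; field.
  by rewrite sqrtr_sqr normrM normfV (gtr0_norm rp).
have [y0|y0] := leP 0 y.
  exists (acos (x / r)); rewrite acosK ?sin_acos ?in_itv//= sr ger0_norm//.
  by split; rewrite mulrC divfK.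
exists (- acos (x / r)); rewrite cosN sinN acosK ?sin_acos ?in_itv//= sr ltr0_norm//.
by rewrite mulNr opprK; split; rewrite mulrC divfK.
Qed.

Let logn z := ln (Normc.normc z ^+ 2).

(** Expanding the square modulus gives m0 m1 + (m0 - 1) (m1 - 1) plus twice the real part of z e^(2
    pi i s), with z = A0 A1 conj(B0 conj(B1)). Since |z| = m0 m1 r, factoring out m0 m1 leaves
    [sqr_dist r], and [th] is the argument of z in full turns. *)
Lemma log_twisted A0 B0 A1 B1 :
  Normc.normc A0 ^+ 2 - Normc.normc B0 ^+ 2 = 1 ->
  Normc.normc A1 ^+ 2 - Normc.normc B1 ^+ 2 = 1 ->
  exists th : R, forall s,
    logn (A0 * A1 + B0 * (B1 * expi (2 * (pi * s)))^*) =
    logn A0 + logn A1 +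
    ln (sqr_dist (Num.sqrt ((1 - expR (- logn A0)) * (1 - expR (- logn A1)))) (s + th)).
Proof.
move=> h0 h1; rewrite /logn.
set m0 := Normc.normc A0 ^+ 2; set m1 := Normc.normc A1 ^+ 2.
have n0 : Normc.normc B0 ^+ 2 = m0 - 1 by rewrite /m0; lra.
have n1 : Normc.normc B1 ^+ 2 = m1 - 1 by rewrite /m1; lra.
have m0_ge : 1 <= m0 by have := sqr_ge0 (Normc.normc B0); lra.
have m1_ge : 1 <= m1 by have := sqr_ge0 (Normc.normc B1); lra.
have m0p : 0 < m0 by lra.
have m1p : 0 < m1 by lra.
rewrite !expRN !lnK ?posrE//.
pose z := A0 * A1 * (B0 * B1^*)^*.
have [th [zx zy]] := polar (complex.Re z) (complex.Im z).
have zn : Num.sqrt (complex.Re z ^+ 2 + complex.Im z ^+ 2) =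
    m0 * m1 * Num.sqrt ((1 - m0^-1) * (1 - m1^-1)).
  rewrite -normc_sqr.
  have -> : Normc.normc z ^+ 2 = (m0 * m1) ^+ 2 * ((1 - m0^-1) * (1 - m1^-1)).
    have -> : Normc.normc z ^+ 2 = m0 * m1 * ((m0 - 1) * (m1 - 1)).
      rewrite -n0 -n1 /m0 /m1 /z !normc_sqr.
      by case: A0 A1 B0 B1 {zx zy z h0 h1 m0 m1 n0 n1 m0_ge m1_ge m0p m1p}
        => [a1 a2] [c1 c2] [b1 b2] [d1 d2] /=; ring.
    by field; rewrite !gt_eqF.
  rewrite sqrtrM ?sqr_ge0// sqrtr_sqr ger0_norm// mulr_ge0// ltW//.
move: zx zy; rewrite zn; set r := Num.sqrt (_ * _) => zx zy.
have r2 : r ^+ 2 = (1 - m0^-1) * (1 - m1^-1).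
  by rewrite sqr_sqrtr// mulr_ge0// subr_ge0 invf_le1.
have r0 : 0 <= r by exact: sqrtr_ge0.
have r1 : r < 1.
  rewrite -[ltRHS]sqrtr1 ltr_sqrt//; apply: mulr_ilt1.
  - by rewrite subr_ge0 invf_le1.
  - by rewrite subr_ge0 invf_le1.
  - by rewrite ltrBlDr ltrDl invr_gt0.
  - by rewrite ltrBlDr ltrDl invr_gt0.
exists th => s.
have mm : m0 * m1 \is Num.pos by rewrite posrE; exact: mulr_gt0.
have X0 : sqr_dist r (s + th) \is Num.pos by rewrite posrE; exact: sqr_dist_gt0.
have m0P : m0 \is Num.pos by rewrite posrE.
have m1P : m1 \is Num.pos by rewrite posrE.
rewrite -(lnM m0P m1P) -(lnM mm X0); congr ln.
rewrite {m0P m1P mm X0} /sqr_dist r2.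
have -> : ccos (s + th) = cos (2 * (pi * s)) * ccos th - sin (2 * (pi * s)) * csin th.
  by rewrite /ccos /csin mulrDr cosD !mulrA.
have -> : m0 * m1 * (1 + (1 - m0^-1) * (1 - m1^-1) + 2 * r *
    (cos (2 * (pi * s)) * ccos th - sin (2 * (pi * s)) * csin th)) =
    m0 * m1 + (m0 - 1) * (m1 - 1) +
    2 * (cos (2 * (pi * s)) * (m0 * m1 * r * ccos th) -
         sin (2 * (pi * s)) * (m0 * m1 * r * csin th)).
  by field; rewrite !gt_eqF.
rewrite -zx -zy -n0 -n1 /m0 /m1 /z !normc_sqr /expi.
move: (2 * (pi * s)) => x; have := cos2Dsin2 x.
move: (cos x) (sin x) => c c' cc'.
case: A0 A1 B0 B1 {zx zy zn z h0 h1 m0 m1 n0 n1 m0_ge m1_ge m0p m1p r r2 r0 r1}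
  => [a1 a2] [d1 d2] [b1 b2] [e1 e2] /=.
have -> : (b1 ^+ 2 + b2 ^+ 2) * (e1 ^+ 2 + e2 ^+ 2) =
  (b1 ^+ 2 + b2 ^+ 2) * (e1 ^+ 2 + e2 ^+ 2) * (c ^+ 2 + c' ^+ 2) by rewrite cc' mulr1.
by ring.
Qed.

End su11_algebra.

(** * Haar integrals over the circle *)

Section circle_integral.
Context {R : realType}.

Lemma measurable_circle d' (T : measurableType d') (f : circle R -> T) :
  measurable_fun [set: measurableTypeR R] (f \o @to_circle R) -> measurable_fun setT f.
Proof.
by move=> mf _ Y mY; rewrite setTI; have := mf measurableT Y mY; rewrite setTI.
Qed.

Lemma integral_circle_haar (f : circle R -> R) (g : R -> R) :
  continuous g -> (forall s, 0 <= g s) -> (forall s, f (to_circle s) = g s) ->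
  (\int[circle_haar R]_t (f t)%:E = (mean g)%:E)%E.
Proof.
move=> cg g0 fg.
have f0 t : 0 <= f t by rewrite -(reprK t) -/(to_circle (repr t)) fg.
have mg : measurable_fun [set: measurableTypeR R] g by exact: continuous_measurable_fun.
have mf : measurable_fun setT f.
  by apply: measurable_circle; apply: eq_measurable_fun mg => s _; rewrite /= fg.
rewrite /circle_haar ge0_integral_distribution//; last exact/measurable_EFinP.
rewrite integral_uniform.
- rewrite subr0 invr1 mul1e /mean /Rintegral fineK.
    by apply: eq_integral => s _; rewrite /= fg.
  by apply: integrable_fin_num => //; exact: continuous_integrable01.
- apply/measurable_EFinP; apply: eq_measurable_fun mg => s _; rewrite /= fg//.
- by move=> s; rewrite lee_fin.
Qed.

Definition circle_expi (t : circle R) : R[i] := expi (2 * (pi * repr t)).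

Lemma circle_conj_su11 t (A B : R[i]) :
  circle_conj t (su11_mx A B) = su11_mx A (B * circle_expi t).
Proof. exact: conjD_su11. Qed.

(** Independence of the representative is inherited from [circle_conj_to_circle], by reading off the
    upper right entry for A = 0 and B = 1. *)
Lemma circle_expi_to_circle (s : R) : circle_expi (to_circle s) = expi (2 * (pi * s)).
Proof.
have := circle_conj_to_circle s (su11_mx (0 : R[i]) 1).
rewrite circle_conj_su11 conjD_su11 !mul1r => /matrixP/(_ 0 1).
by rewrite !mxE.
Qed.

Lemma normc_circle_expi t : Normc.normc (circle_expi t) ^+ 2 = 1.
Proof. by rewrite normc_sqr cos2Dsin2. Qed.

Lemma SU11_circle_conj t (H : 'M[R[i]]_2) : SU11 H -> SU11 (circle_conj t H).
Proof.
move=> [A [B [AB ->]]]; exists A, (B * circle_expi t); split; last exact: circle_conj_su11.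
by rewrite Normc.normcM exprMn normc_circle_expi mulr1.
Qed.

Lemma SU11E (H : 'M[R[i]]_2) : SU11 H -> H = su11_mx (H 0 0) (H 0 1).
Proof. by move=> [A [B [_ ->]]]; rewrite !mxE. Qed.

Lemma SU11_norm (H : 'M[R[i]]_2) : SU11 H ->
  Normc.normc (H 0 0) ^+ 2 - Normc.normc (H 0 1) ^+ 2 = 1.
Proof. by move=> [A [B [AB ->]]]; rewrite !mxE. Qed.

Lemma ln_normc_ge0 (H : 'M[R[i]]_2) : SU11 H -> 0 <= ln (Normc.normc (H 0 0) ^+ 2).
Proof.
move=> /SU11_norm h; apply: ln_ge0.
by have := sqr_ge0 (Normc.normc (H 0 1)); lra.
Qed.

End circle_integral.

Section one_step.
Context {R : realType} (p q : R).
Context (p1 : 1 < p) (p2 : p < 2) (q2 : 2 < q).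
Context (pq : pow_mean (q / 2) 1 <= 2 `^ (q / p) :> R).

(** The linear inequality is used at the square roots of the two logarithms, which turns its
    exponent [p] into [p / 2]. The rotation [th] disappears because the mean of a periodic function
    is invariant under shifts. *)
Lemma circle_step (H0 H1 : 'M[R[i]]_2) : SU11 H0 -> SU11 H1 ->
  (\int[circle_haar R]_t
     (ln (Normc.normc ((H0 *m circle_conj t H1) 0 0) ^+ 2) `^ (q / 2))%:E <=
   ((ln (Normc.normc (H0 0 0) ^+ 2) `^ (p / 2) +
     ln (Normc.normc (H1 0 0) ^+ 2) `^ (p / 2)) `^ (q / p))%:E)%E.
Proof.
move=> S0 S1; have l0 := ln_normc_ge0 S0; have l1 := ln_normc_ge0 S1.
have [th hth] := log_twisted (SU11_norm S0) (SU11_norm S1).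
have p0 : 0 < p by move: p1; lra.
have a1 : 1 <= q / 2 by move: q2; lra.
have C := mean_log_le l0 l1 a1.
have T := two_point p1 p2 q2 pq (sqrtr_ge0 _) (sqrtr_ge0 _).
move: C {T} (T (ln (Normc.normc (H0 0 0) ^+ 2)) (ln (Normc.normc (H1 0 0) ^+ 2))) hth.
rewrite !sqr_sqrtr//.
have P u : 0 <= u -> Num.sqrt u `^ p = u `^ (p / 2).
  by move=> u0; rewrite -powR12_sqrt// -powRrM mulrC.
rewrite !P// -mulrA -sqrtrM//.
set u := ln _ in l0 *; set v := ln _ in l1 *; set r := Num.sqrt (_ * (1 - _)).
move=> C T hth.
pose g s := (u + v + ln (sqr_dist r s)) `^ (q / 2).
have S01 t := SU11_mulmx S0 (SU11_circle_conj t S1).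
have ps s : u + v + ln (sqr_dist r (s + th)) =
    ln (Normc.normc ((H0 *m circle_conj (to_circle s) H1) 0 0) ^+ 2).
  rewrite {1}(SU11E S0) {1}(SU11E S1) circle_conj_su11 circle_expi_to_circle.
  by rewrite su11_mx_mul [in RHS]mxE /= hth.
have r01 : 0 <= r < 1.
  rewrite sqrtr_ge0/= -[ltRHS]sqrtr1 ltr_sqrt//; apply: mulr_ilt1.
  - by rewrite subr_ge0 -{1}(expR0 R) ler_expR oppr_le0.
  - by rewrite subr_ge0 -{1}(expR0 R) ler_expR oppr_le0.
  - by rewrite ltrBlDr ltrDl expR_gt0.
  - by rewrite ltrBlDr ltrDl expR_gt0.
have /andP[r0 r1] := r01.
(* At every point the argument is log |a|^2 of some matrix in SU(1,1), hence nonnegative. *)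
have arg_ge0 s : 0 <= u + v + ln (sqr_dist r s).
  by have := ps (s - th); rewrite subrK => ->; exact: ln_normc_ge0.
have cg : continuous g.
  apply: cts_powR => //; first by move: q2; lra.
  apply: ctsD; first exact: cts_cst.
  by apply: cts_ln; [exact: continuous_sqr_dist|move=> t; exact: sqr_dist_gt0].
have cgs : continuous (fun s => g (s + th)).
  have ca : continuous (fun t : R => t + th) by apply: ctsD; [exact: cts_id|exact: cts_cst].
  exact: (cts_comp ca cg).
rewrite (integral_circle_haar (g := fun s => g (s + th)) cgs).
- rewrite lee_fin mean_shift//; last by move=> t; rewrite /g sqr_distD1.
  by apply: le_trans C _; exact: T.
- by move=> s; exact: powR_ge0.
- by move=> s; rewrite /g ps.
Qed.

End one_step.

(** * Measurability of the twisted products *)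

Section measurability.
Context {R : realType} {d'} {T : measurableType d'}.
Local Open Scope complex_scope.

Definition measurableC (f : T -> R[i]) : Prop :=
  measurable_fun setT (fun t => complex.Re (f t)) /\
  measurable_fun setT (fun t => complex.Im (f t)).

Lemma measurableCD f g : measurableC f -> measurableC g -> measurableC (fun t => f t + g t).
Proof.
move=> [f1 f2] [g1 g2]; split.
- apply: eq_measurable_fun (measurable_funD f1 g1) => t _ /=.
  by case: (f t) (g t) => [a b] [c e].
- apply: eq_measurable_fun (measurable_funD f2 g2) => t _ /=.
  by case: (f t) (g t) => [a b] [c e].
Qed.

Lemma measurableCM f g : measurableC f -> measurableC g -> measurableC (fun t => f t * g t).
Proof.
move=> [f1 f2] [g1 g2]; split.
- apply: eq_measurable_fun (measurable_funB (measurable_funM f1 g1) (measurable_funM f2 g2)) => t _ /=.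
  by case: (f t) (g t) => [a b] [c e].
- apply: eq_measurable_fun (measurable_funD (measurable_funM f1 g2) (measurable_funM f2 g1)) => t _ /=.
  by case: (f t) (g t) => [a b] [c e].
Qed.

Lemma measurableCJ f : measurableC f -> measurableC (fun t => (f t)^*).
Proof.
move=> [f1 f2]; split.
- by apply: eq_measurable_fun f1 => t _ /=; case: (f t).
- have h0 : measurable_fun [set: T] (fun=> 0 : R) by exact: measurable_cst.
  have := measurable_funB h0 f2; apply: eq_measurable_fun => t _ /=.
  by case: (f t) => a b /=; rewrite sub0r.
Qed.

Lemma measurable_ln_normc f : measurableC f ->
  measurable_fun setT (fun t => ln (Normc.normc (f t) ^+ 2)).
Proof.
move=> [f1 f2]; apply: measurableT_comp; first exact: measurable_ln.
have := measurable_funD (measurable_funM f1 f1) (measurable_funM f2 f2).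
by apply: eq_measurable_fun => t _ /=; rewrite normc_sqr !expr2.
Qed.

End measurability.

Section twisted.
Context {R : realType} (d : nat) (A B : d.-tuple bool -> R[i]).
Context (AB : forall w, Normc.normc (A w) ^+ 2 - Normc.normc (B w) ^+ 2 = 1).

Let G w := su11_mx (A w) (B w).

Definition tuple_init n T (t : n.+1.-tuple T) : n.-tuple T :=
  [tuple tnth t (widen_ord (leqnSn n) i) | i < n].

Lemma tuple_init_rcons d' (T : measurableType d') n (t : n.-tuple T) (y : T) :
  tuple_init (tuple_rcons (t, y)) = t.
Proof.
apply: eq_from_tnth => i; rewrite tnth_mktuple (tnth_nth y) /= nth_rcons size_tuple.
by rewrite ltn_ord (tnth_nth y).
Qed.

Lemma tnth_max_rcons d' (T : measurableType d') n (t : n.-tuple T) (y : T) :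
  tnth (tuple_rcons (t, y)) ord_max = y.
Proof. by rewrite (tnth_nth y) /= nth_rcons size_tuple ltnn eqxx. Qed.

Lemma measurable_tuple_init d' (T : measurableType d') n :
  measurable_fun setT (@tuple_init n T).
Proof.
apply/measurable_fun_tnthP => i.
apply: eq_measurable_fun (measurable_tnth (widen_ord (leqnSn n) i)) => t _ /=.
by rewrite tnth_mktuple.
Qed.

Lemma twisted_product_SU11 n k (e : (k + n = d)%N) (w : k.-tuple bool)
  (t : n.-tuple (circle R)) : SU11 (twisted_product G e w t).
Proof.
elim: n k e w t => [|n IH] k e w t /=; first by exists (A (tcast (etrans (esym (addn0 k)) e) w)), (B (tcast (etrans (esym (addn0 k)) e) w)).
by apply: SU11_mulmx; [|apply: SU11_circle_conj]; exact: IH.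
Qed.

Let child n k (e : (k + n.+1 = d)%N) (w : k.-tuple bool) b t :=
  twisted_product G (etrans (addSnnS k n) e) [tuple of rcons w b] t.

Lemma twisted_product_rcons n k (e : (k + n.+1 = d)%N) (w : k.-tuple bool) t y :
  twisted_product G e w (tuple_rcons (t, y)) =
  child e w false t *m circle_conj y (child e w true t).
Proof.
by rewrite /= -/(tuple_init _) tuple_init_rcons tnth_max_rcons.
Qed.

Lemma measurableC_circle_expi : measurableC (@circle_expi R).
Proof.
have c1 : continuous (fun s : R => 2 * (pi * s)).
  by apply: ctsM; [exact: cts_cst|apply: ctsM; [exact: cts_cst|exact: cts_id]].
split; apply: measurable_circle.
- have h : measurable_fun [set: measurableTypeR R] (fun s : R => cos (2 * (pi * s))).
    by apply: continuous_measurable_fun; exact: (cts_comp c1 (@continuous_cos R)).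
  apply: eq_measurable_fun h => s _.
  by rewrite -[RHS]/(complex.Re (circle_expi (to_circle s))) circle_expi_to_circle.
- have h : measurable_fun [set: measurableTypeR R] (fun s : R => sin (2 * (pi * s))).
    by apply: continuous_measurable_fun; exact: (cts_comp c1 (@continuous_sin R)).
  apply: eq_measurable_fun h => s _.
  by rewrite -[RHS]/(complex.Im (circle_expi (to_circle s))) circle_expi_to_circle.
Qed.

Lemma measurableC_comp d1 d2 (T1 : measurableType d1) (T2 : measurableType d2)
    (f : T2 -> R[i]) (g : T1 -> T2) :
  measurableC f -> measurable_fun setT g -> measurableC (f \o g).
Proof. by move=> [f1 f2] mg; split; [exact: (measurableT_comp f1)|exact: (measurableT_comp f2)]. Qed.

(** Both entries of the first row are carried through the induction, since each new entry is a
    polynomial in the old ones, their conjugates, and [circle_expi] of the last coordinate and its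
    conjugate. *)
Lemma twisted_product_measurable n k (e : (k + n = d)%N) (w : k.-tuple bool) :
  measurableC (fun t => twisted_product G e w t 0 0) /\
  measurableC (fun t => twisted_product G e w t 0 1).
Proof.
elim: n k e w => [|n IH] k e w.
  by split; split; exact: measurable_cst.
have mi := @measurable_tuple_init _ (circle R) n.
have [f0 f1] := IH _ (etrans (addSnnS k n) e) [tuple of rcons w false].
have [g0 g1] := IH _ (etrans (addSnnS k n) e) [tuple of rcons w true].
have {}f0 := measurableC_comp f0 mi; have {}f1 := measurableC_comp f1 mi.
have {}g0 := measurableC_comp g0 mi; have {}g1 := measurableC_comp g1 mi.
have me := measurableC_comp measurableC_circle_expi (@measurable_tnth _ (circle R) n.+1 ord_max).
have E t : twisted_product G e w t = su11_mx
   (child e w false (tuple_init t) 0 0 * child e w true (tuple_init t) 0 0 +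
    child e w false (tuple_init t) 0 1 *
    conjc (child e w true (tuple_init t) 0 1 * circle_expi (tnth t ord_max)))
   (child e w false (tuple_init t) 0 0 *
    (child e w true (tuple_init t) 0 1 * circle_expi (tnth t ord_max)) +
    child e w false (tuple_init t) 0 1 * conjc (child e w true (tuple_init t) 0 0)).
  rewrite -su11_mx_mul -circle_conj_su11.
  by rewrite -!SU11E//; exact: twisted_product_SU11.
split.
- have := measurableCD (measurableCM f0 g0) (measurableCM f1 (measurableCJ (measurableCM g1 me))).
  by congr measurableC; apply/funext => t; rewrite E mxE.
- have := measurableCD (measurableCM f0 (measurableCM g1 me)) (measurableCM f1 (measurableCJ g0)).
  by congr measurableC; apply/funext => t; rewrite E mxE.
Qed.

End twisted.

(** * Minkowski's inequality and the induction over the binary tree of words *)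

Lemma minkowski_pow d' (T : measurableType d') (R : realType)
    (mu : {measure set T -> \bar R}) (f g : T -> R) (r a b : R) :
  measurable_fun setT f -> measurable_fun setT g ->
  (forall t, 0 <= f t) -> (forall t, 0 <= g t) -> 0 <= a -> 0 <= b -> 1 <= r ->
  (\int[mu]_t (f t `^ r)%:E <= (a `^ r)%:E)%E ->
  (\int[mu]_t (g t `^ r)%:E <= (b `^ r)%:E)%E ->
  (\int[mu]_t ((f t + g t) `^ r)%:E <= ((a + b) `^ r)%:E)%E.
Proof.
move=> mf mg f0 g0 a0 b0 r1 fa gb; have r0 : 0 < r by lra.
have pow_int (h : T -> R) : (forall t, 0 <= h t) ->
    (\int[mu]_t (h t `^ r)%:E = \int[mu]_t (`|(EFin \o h) t| `^ r))%E.
  by move=> h0; apply: eq_integral => t _ /=; rewrite ger0_norm.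
have norm_le (h : T -> R) (c : R) : (forall t, 0 <= h t) -> 0 <= c ->
    (\int[mu]_t (h t `^ r)%:E <= (c `^ r)%:E)%E -> ('N[mu]_r%:E[EFin \o h] <= c%:E)%E.
  move=> h0 c0 hc; rewrite unlock -pow_int//.
  have -> : c%:E = ((c `^ r)%:E `^ r^-1)%E.
    by rewrite poweR_EFin -powRrM mulfV ?gt_eqF// powRr1.
  apply: gt0_ler_poweR => //.
  - by rewrite invr_ge0 ltW.
  - by rewrite in_itv/= leey andbT integral_ge0// => t _; rewrite lee_fin powR_ge0.
  - by rewrite in_itv/= leey andbT lee_fin powR_ge0.
rewrite (pow_int (fun t => f t + g t)) => [|t]; last by rewrite addr_ge0.
rewrite -poweR_Lnorm ?gt_eqF// -poweR_EFin.
apply: gt0_ler_poweR; first exact: ltW.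
- by rewrite in_itv/= leey andbT Lnorm_ge0.
- by rewrite in_itv/= leey andbT lee_fin addr_ge0.
apply: le_trans (minkowski_EFin mu mf mg r1) _.
by rewrite EFinD leeD// norm_le.
Qed.

Section induction.
Context {R : realType} (p q : R) (d : nat) (A B : d.-tuple bool -> R[i]).
Context (p1 : 1 < p) (p2 : p < 2) (q2 : 2 < q).
Context (pq : pow_mean (q / 2) 1 <= 2 `^ (q / p) :> R).
Context (AB : forall w, Normc.normc (A w) ^+ 2 - Normc.normc (B w) ^+ 2 = 1).

Let G w := su11_mx (A w) (B w).

Let F n k (e : (k + n = d)%N) (w : k.-tuple bool) (t : n.-tuple (circle R)) :=
  ln (Normc.normc (twisted_product G e w t 0 0) ^+ 2).

Let mF n k (e : (k + n = d)%N) w : measurable_fun setT (@F n k e w).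
Proof. exact: (measurable_ln_normc (twisted_product_measurable AB e w).1). Qed.

(** The right-hand side of the theorem restricted to the leaves below the node [w] of the binary
    tree of words. *)
Let prefix_sum k (w : k.-tuple bool) : R :=
  \sum_(v : d.-tuple bool | take k v == w) ln (Normc.normc (A v) ^+ 2) `^ (p / 2).

Let prefix_sum_ge0 k (w : k.-tuple bool) : 0 <= prefix_sum w.
Proof. by apply: sumr_ge0 => v _; exact: powR_ge0. Qed.

Let prefix_sum_rcons k (w : k.-tuple bool) : (k < d)%N ->
  prefix_sum w = prefix_sum [tuple of rcons w false] + prefix_sum [tuple of rcons w true].
Proof.
move=> kd; rewrite /prefix_sum (bigID (fun v : d.-tuple bool => nth false v k)) /= addrC.
have E b (v : d.-tuple bool) :
    (take k.+1 v == rcons w b) = (take k v == w) && (nth false v k == b).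
  by rewrite (take_nth false) ?size_tuple// eqseq_rcons.
congr (_ + _); apply: eq_bigl => v; rewrite E; first by rewrite eqbF_neg.
by rewrite eqb_id.
Qed.

Let prefix_sum_full k (e : (k + 0 = d)%N) (w : k.-tuple bool) :
  prefix_sum w = ln (Normc.normc (A (tcast (etrans (esym (addn0 k)) e) w)) ^+ 2) `^ (p / 2).
Proof.
rewrite /prefix_sum (big_pred1 (tcast (etrans (esym (addn0 k)) e) w))// => v /=.
rewrite -val_eqE /= val_tcast.
by rewrite take_oversize// size_tuple -e addn0.
Qed.

(** The last coordinate is integrated first, with the coordinates common to both children fixed. The
    resulting integrand is the (q/p)-th power of a sum over the children, each of which the
    induction hypothesis controls after [(p / 2) * (q / p) = q / 2]; Minkowski applies because
    [1 <= q / p]. *)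
Lemma integral_twisted_product n k (e : (k + n = d)%N) (w : k.-tuple bool) :
  (\int[torus_haar R n]_t (F e w t `^ (q / 2))%:E <= (prefix_sum w `^ (q / p))%:E)%E.
Proof.
have p0 : 0 < p by move: p1; lra.
have q0 : 0 < q by move: q2; lra.
have pqE (x : R) : (x `^ (p / 2)) `^ (q / p) = x `^ (q / 2).
  by rewrite -powRrM; congr powR; field; rewrite gt_eqF.
elim: n k e w => [|n IH] k e w.
  rewrite /torus_haar /= integral_dirac//; last first.
    by apply/measurable_EFinP; exact: (measurableT_comp (@measurable_powR R (q / 2)) (mF e w)).
  rewrite diracT mul1e prefix_sum_full pqE lee_fin /F /= /su11_mx /mx2 !mxE//.
have kd : (k < d)%N by rewrite -e -addSnnS leq_addr.
pose e' := etrans (addSnnS k n) e.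
pose w0 := [tuple of rcons w false]; pose w1 := [tuple of rcons w true].
have mFq : measurable_fun setT (fun t => (F e w t `^ (q / 2))%:E).
  by apply/measurable_EFinP; exact: (measurableT_comp (@measurable_powR R (q / 2)) (mF e w)).
have Fq0 t : (0 <= (F e w t `^ (q / 2))%:E)%E by rewrite lee_fin powR_ge0.
have mr : measurable_fun setT
    (fun z => (F e w (@tuple_rcons _ (circle R) n z) `^ (q / 2))%:E).
  exact: (measurableT_comp mFq (@measurable_tuple_rcons _ (circle R) n)).
rewrite /torus_haar /= ge0_integral_distribution// fubini_tonelli1//; last by move=> z; exact: Fq0.
have mb b : measurable_fun setT (fun t => F e' [tuple of rcons w b] t `^ (p / 2)).
  exact: (measurableT_comp (@measurable_powR R (p / 2)) (mF _ _)).
apply: (@le_trans _ _ (\int[torus_haar R n]_t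
    ((F e' w0 t `^ (p / 2) + F e' w1 t `^ (p / 2)) `^ (q / p))%:E)%E).
  apply: ge0_le_integral => //.
  - by move=> t _; apply: integral_ge0 => y _; exact: Fq0.
  - exact: (measurable_fun_fubini_tonelli_F _ mr (fun z => Fq0 _)).
  - apply/measurable_EFinP.
    exact: (measurableT_comp (@measurable_powR R (q / p)) (measurable_funD (mb false) (mb true))).
  move=> t _; rewrite /fubini_F.
  have := circle_step p1 p2 q2 pq (twisted_product_SU11 AB e' w0 t) (twisted_product_SU11 AB e' w1 t).
  apply: le_trans; rewrite le_eqVlt; apply/orP; left; apply/eqP.
  by apply: eq_integral => y _; rewrite /= /F twisted_product_rcons.
rewrite (prefix_sum_rcons w kd).
have r1 : 1 <= q / p by rewrite ler_pdivlMr// mul1r; move: p2 q2; lra.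
have I b : (\int[torus_haar R n]_t
    ((F e' [tuple of rcons w b] t `^ (p / 2)) `^ (q / p))%:E <=
    (prefix_sum [tuple of rcons w b] `^ (q / p))%:E)%E.
  by apply: le_trans (IH _ e' [tuple of rcons w b]); under eq_integral do rewrite pqE.
exact: (minkowski_pow (mb false) (mb true) (fun t => powR_ge0 _ _)
  (fun t => powR_ge0 _ _) (prefix_sum_ge0 w0) (prefix_sum_ge0 w1) r1 (I false) (I true)).
Qed.

End induction.

Unset Implicit Arguments.
Theorem theorem1 (R : realType) (p q : R) (d : nat)
    (A B : d.-tuple bool -> R[i]) :
  1 < p -> p < 2 -> 2 < q ->
  1 / p >= 1 / q * log2 (central_binomial q) ->
  (1 <= d)%N ->
  (forall w, Normc.normc (A w) ^+ 2 - Normc.normc (B w) ^+ 2 = 1) ->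
  let G := fun w => su11_mx (A w) (B w) in
  (forall (n k : nat) (e : (k + n = d)%N) (s : k.-tuple bool)
     (t : n.-tuple (circle R)), SU11 (twisted_product G e s t)) /\
  (let a := fun t : d.-tuple (circle R) =>
    twisted_product G (erefl d : (0 + d = d)%N) (nil_tuple bool) t 0 0 in
  ('N[torus_haar R d]_q%:E
     [EFin \o (fun t => ln (Normc.normc (a t) ^+ 2) `^ (1 / 2))%R] <=
   ((\sum_(w : d.-tuple bool) ln (Normc.normc (A w) ^+ 2) `^ (p / 2))
      `^ (1 / p))%R%:E)%E).
Proof.
move=> p1 p2 q2 pq _ AB G; split; first by move=> n k e s t; exact: twisted_product_SU11.
move=> a; have p0 : 0 < p by lra.
have q0 : 0 < q by lra.
have Q : pow_mean (q / 2) 1 <= 2 `^ (q / p) :> R.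
  have C := @pow_mean_le_central R (q / 2) ltac:(lra).
  rewrite (_ : 2 * (q / 2) = q) in C; last by field.
  apply: le_trans C _; move: (central_binomial q) pq => C.
  (* The logarithmic hypothesis is informative for positive [C]; for [C <= 0] the bound is
     immediate, since a power is nonnegative. *)
  have [C0 _|C0] := leP C 0; first by rewrite (le_trans C0)// powR_ge0.
  have l2 : 0 < ln 2 :> R by rewrite ln_gt0// ltr1n.
  rewrite /log2 mulrA ler_pdivrMr// => H.
  rewrite -ler_ln ?posrE ?powR_gt0// ln_powR.
  have := ler_wpM2l (ltW q0) H.
  rewrite (_ : q * (1 / q * ln C) = ln C); last by field; rewrite gt_eqF.
  by rewrite (_ : q * (1 / p * ln 2) = q / p * ln 2)//; field; rewrite gt_eqF.
have := integral_twisted_product p1 p2 q2 Q AB (erefl d : (0 + d = d)%N) (nil_tuple bool).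
set S := \sum_(w | _) _ => H.
have -> : \sum_w ln (Normc.normc (A w) ^+ 2) `^ (p / 2) = S.
  by apply: eq_bigl => v; rewrite take0.
have S0 : 0 <= S by apply: sumr_ge0 => v _; exact: powR_ge0.
rewrite unlock.
(* The bound is written as a q-th root, so that monotonicity of the root reduces the claim to the
   integral of q-th powers. *)
have -> : (S `^ (1 / p))%:E = ((S `^ (q / p))%:E `^ q^-1)%E.
  rewrite poweR_EFin -powRrM; congr (_ `^ _)%:E; field.
  by rewrite !gt_eqF.
apply: gt0_ler_poweR.
- by rewrite invr_ge0 ltW.
- by rewrite in_itv/= leey andbT integral_ge0// => t _; exact: poweR_ge0.
- by rewrite in_itv/= leey andbT lee_fin powR_ge0.
apply: le_trans H; rewrite le_eqVlt; apply/orP; left; apply/eqP.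
apply: eq_integral => t _ /=.
by rewrite ger0_norm ?powR_ge0// -powRrM; congr (_ `^ _)%:E; field.
Qed.
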